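(* Let $(X,X^+)$ be an ordered Banach space with total cone and let $A: X \supseteq \operatorname{dom}(A) \to X$ be a resolvent positive linear operator; assume that $s_{\mathrm{ess}}(A) < 0$. Then the following assertions are equivalent: (i) The spectral bound of $A$ satisfies $s(A) < 0$. (ii) The operator $A$ is invertible (i.e. $0$ is in the resolvent set of $A$) and the resolvent $-A^{-1} = \mathcal{R}(0,A)$ is positive. (iii) If $x \in \operatorname{dom}(A)$ satisfies $Ax \ge 0$, then $x \le 0$. (iv) For each non-zero $0 \le x \in \operatorname{dom}(A)$ one has $Ax \not\ge 0$.
   Context: An ordered Banach space $(X,X^+)$ is a real Banach space $X$ together with a closed convex cone $X^+$ (so $X^+ + X^+ \subseteq X^+$ and $[0,\infty)X^+ \subseteq X^+$) with $X^+ \cap (-X^+) = \{0\}$; $x\le y$ means $y-x\in X^+$. The cone is total if $X^+ - X^+$ is dense in $X$. A bounded linear operator $T$ on $X$ is positive if $TX^+ \subseteq X^+$. Spectral notions for a closed operator $A$ on $X$ (spectrum $\sigma(A)$, essential spectrum, resolvent set $\rho(A)$, resolvent $\mathcal{R}(\lambda,A)=(\lambda-A)^{-1}$) refer to the canonical extension of $A$ to a complexification of $X$. $A$ is resolvent positive if there is $\omega\in\mathbb{R}$ such that $(\omega,\infty)\subseteq\rho(A)$ and $\mathcal{R}(\lambda,A)$ is positive for each $\lambda\in(\omega,\infty)$. The spectral bound is $s(A) := \sup\{\operatorname{Re}\lambda:\lambda\in\sigma(A)\}\in[-\infty,\infty]$. The essential spectrum $\sigma_{\mathrm{ess}}(A)$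 is the set of $\lambda\in\mathbb{C}$ such that $\lambda\,\mathrm{id} - A$, as a bounded operator from $\operatorname{dom}(A)$ (with the graph norm) to the underlying Banach space, is not Fredholm (Fredholm: finite-dimensional kernel and range of finite codimension). The essential spectral bound is $s_{\mathrm{ess}}(A) := \sup\{\operatorname{Re}\lambda:\lambda\in\sigma_{\mathrm{ess}}(A)\}\in[-\infty,\infty]$. Convention: $\sup\emptyset=-\infty$. *)

(* Defs.v *)
From HB Require Import structures.
From mathcomp Require Import all_boot all_order all_algebra.
From mathcomp Require Import complex.
From mathcomp Require Import all_classical all_reals all_analysis.

Set Implicit Arguments.
Unset Strict Implicit.
Unset Printing Implicit Defensive.

Import Order.TTheory GRing.Theory Num.Theory.
Import numFieldNormedType.Exports.

Local Open Scope classical_set_scope.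
Local Open Scope ring_scope.
Local Open Scope complex_scope.

Record ordered_banach (R : realType) (X : completeNormedModType R)
    (C : set X) : Prop := OrderedBanach {
  cone_closed : closed C;
  coneD : forall x y, C x -> C y -> C (x + y);
  coneZ : forall (a : R) x, 0 <= a -> C x -> C (a *: x);
  cone_pointed : C `&` [set x | C (- x)] = [set 0] }.

Definition cone_le (R : realType) (X : completeNormedModType R) (C : set X)
  (x y : X) : Prop := C (y - x).

Definition total_cone (R : realType) (X : completeNormedModType R)
  (C : set X) : Prop := dense [set x - y | x in C & y in C].

Definition positive_op (R : realType) (X : completeNormedModType R)
  (C : set X) (T : X -> X) : Prop := forall x, C x -> C (T x).

(* A linear operator on the subspace [dom] of V; the values of [op] outside [dom] are junk
   and are never used below. *)
Record linop (K : pzRingType) (V : lmodType K) := Linop {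
  dom : set V;
  op :> V -> V;
  dom0 : dom 0;
  dom_linear : forall (a : K) x y, dom x -> dom y -> dom (a *: x + y);
  op_linear : forall (a : K) x y, dom x -> dom y ->
    op (a *: x + y) = a *: op x + op y }.

Section Spectrum.
Variables (K : numFieldType) (V : normedModType K).
Implicit Types (B : linop V) (l : K).

Lemma shift_op_linear B l (a : K) x y : dom B x -> dom B y ->
  l *: (a *: x + y) - B (a *: x + y) =
  a *: (l *: x - B x) + (l *: y - B y).
Proof.
move=> Bx By; rewrite op_linear// scalerDr scalerBr !scalerA (mulrC a).
by rewrite opprD addrACA.
Qed.

Definition shift_op B l : linop V :=
  @Linop K V (dom B) (fun x => l *: x - B x) (dom0 B)
    (@dom_linear _ _ B) (shift_op_linear (B := B) l).

(* This is (l - B)^-1 when l - B maps dom B bijectively onto V. *)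
Definition resolvent B l : V -> V :=
  'pinv_(fun=> 0) (dom B) (shift_op B l).

Definition bounded_op (T : V -> V) : Prop :=
  exists M : K, forall y, `|T y| <= M * `|y|.

Definition resolvent_set B : set K :=
  [set l | set_bij (dom B) [set: V] (shift_op B l) /\
           bounded_op (resolvent B l)].

Definition spectrum B : set K := ~` resolvent_set B.

Definition finite_dim (S : set V) : Prop :=
  exists (n : nat) (v : 'I_n -> V),
    S = [set \sum_(i < n) c i *: v i | c in [set: 'I_n -> K]].

(* the quotient V / S is spanned by the classes of finitely many vectors *)
Definition finite_codim (S : set V) : Prop :=
  exists (n : nat) (v : 'I_n -> V), forall y : V,
    exists c : 'I_n -> K, S (y - \sum_(i < n) c i *: v i).

(* Continuity of B for the graph norm of its domain need not be required of the
   operators l - B considered here: `|l *: x - B x| <= `|l| * `|x| + `|B x|. *)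
Definition fredholm B : Prop :=
  finite_dim [set x | dom B x /\ B x = 0] /\ finite_codim (B @` dom B).

Definition essential_spectrum B : set K :=
  [set l | ~ fredholm (shift_op B l)].

End Spectrum.

(* The complexification of X, with (x, y) standing for x + i y, is a complex
   Banach space for the Taylor norm
     |z| = sup {|Re (u z)| : u complex, |u| = 1},
   which is equivalent to the product norm. *)
Definition complexification (R : realType) (X : normedModType R) : Type :=
  (X * X)%type.

Section Complexification.
Variables (R : realType) (X : normedModType R).
Local Notation XC := (complexification X).

HB.instance Definition _ := GRing.Zmodule.copy XC (X * X)%type.

Definition cplx_scale (l : R[i]) (z : XC) : XC :=
  (complex.Re l *: z.1 - complex.Im l *: z.2,
   complex.Re l *: z.2 + complex.Im l *: z.1).

Lemma cplx_scaleA a b z :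
  cplx_scale a (cplx_scale b z) = cplx_scale (a * b) z.
Proof.
case: a b z => [a a'] [b b'] [x y]; rewrite /cplx_scale/=.
rewrite !(scalerBr, scalerDr, scalerBl, scalerDl) !scalerA.
congr pair.
  by rewrite opprD (addrC (- (_ *: y))) addrACA opprD.
by rewrite (addrC ((a' * b) *: x)) addrACA.
Qed.

Lemma cplx_scale1 : left_id 1 cplx_scale.
Proof.
by case=> x y; rewrite /cplx_scale/= !scale1r !scale0r subr0 addr0.
Qed.

Lemma cplx_scaleDr : right_distributive cplx_scale +%R.
Proof.
move=> a [x y] [x' y']; rewrite /cplx_scale/=.
by congr pair; rewrite /= !scalerDr ?opprD addrACA.
Qed.

Lemma cplx_scaleDl z : {morph cplx_scale^~ z : a b / a + b}.
Proof.
move=> [a a'] [b b']; rewrite /cplx_scale/=.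
by congr pair; rewrite /= !scalerDl ?opprD addrACA.
Qed.

HB.instance Definition _ := GRing.Zmodule_isLmodule.Build R[i] XC
  cplx_scaleA cplx_scale1 cplx_scaleDr cplx_scaleDl.

Definition taylor_norm (z : XC) : R :=
  sup [set `|(u *: z : XC).1| | u in [set u : R[i] | `|u| = 1]].

Let absc (l : R[i]) : R := complex.Re `|l|.

Let abscE l : `|l| = (absc l)%:C.
Proof. by rewrite /absc normc_def. Qed.

Let taylor_bound z (u : R[i]) : `|u| = 1 ->
  `|(u *: z : XC).1| <= `|z.1| + `|z.2|.
Proof.
move=> u1.
have uRe : `|complex.Re u| <= 1 by rewrite -lecR (le_trans (normc_ge_Re u))// u1.
have uIm : `|complex.Im u| <= 1.
  rewrite -lecR -[complex.Im u]opprK -ReiNIm normrN.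
  rewrite (le_trans (normc_ge_Re _))// normrM u1 mul1r normc_def/=.
  by rewrite expr0n/= add0r expr1n sqrtr1.
rewrite (le_trans (ler_normB _ _))// !normrZ.
by rewrite lerD// ler_piMl.
Qed.

Let has_sup_taylor z :
  has_sup [set `|(u *: z : XC).1| | u in [set u : R[i] | `|u| = 1]].
Proof.
split; first by exists `|((1 : R[i]) *: z : XC).1|, 1 => //=; rewrite normr1.
exists (`|z.1| + `|z.2|) => _ [u /= u1 <-].
exact: taylor_bound.
Qed.

Let taylor_ub z u : `|u| = 1 -> `|(u *: z : XC).1| <= taylor_norm z.
Proof.
move=> u1; apply: sup_upper_bound; first exact: has_sup_taylor.
by exists u.
Qed.

Let taylor_lub z (M : R) :
  (forall u : R[i], `|u| = 1 -> `|(u *: z : XC).1| <= M) -> taylor_norm z <= M.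
Proof.
move=> zM; apply: ge_sup; first by have [] := has_sup_taylor z.
by move=> _ [u /= u1 <-]; exact: zM.
Qed.

Let Re_scale (a : R) z : (a%:C *: z : XC).1 = a *: z.1.
Proof. by rewrite /= scale0r subr0. Qed.

Let taylor_scale z l : `|(l *: z : XC).1| <= absc l * taylor_norm z.
Proof.
have [->|l0] := eqVneq l 0.
  by rewrite scale0r /absc !normr0 mul0r.
have al0 : 0 < absc l by rewrite -ltcR -abscE normr_gt0.
have -> : l *: z = (absc l)%:C *: (((absc l)%:C^-1 * l) *: z).
  by rewrite scalerA mulrA divff ?mul1r// -abscE normr_eq0.
rewrite Re_scale normrZ gtr0_norm// ler_pM2l//; apply: taylor_ub.
by rewrite normrM normfV -abscE normr_id mulVf// normr_eq0.
Qed.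

Let taylor_leZ l z : taylor_norm (l *: z) <= absc l * taylor_norm z.
Proof.
apply: taylor_lub => u u1; rewrite scalerA (le_trans (taylor_scale _ _))//.
by rewrite /absc normrM u1 mul1r.
Qed.

Lemma taylor_normZ l z : (taylor_norm (l *: z))%:C = `|l| * (taylor_norm z)%:C.
Proof.
have tn0 y : 0 <= taylor_norm y.
  by rewrite (le_trans _ (@taylor_ub y 1 _))// normr1.
rewrite abscE -rmorphM/=; congr (_%:C); apply/eqP; rewrite eq_le taylor_leZ/=.
have [->|l0] := eqVneq l 0; first by rewrite /absc normr0 mul0r.
have al0 : 0 < absc l by rewrite -ltcR -abscE normr_gt0.
have c1 : absc l * absc l^-1 = 1.
  by apply: complexI; rewrite rmorphM/= -!abscE -normrM divff// normr1.
have := taylor_leZ l^-1 (l *: z); rewrite scalerA mulVf// scale1r.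
by rewrite -(ler_pM2l al0) mulrA c1 mul1r.
Qed.

Lemma taylor_normD (x y : XC) :
  (taylor_norm (x + y))%:C <= (taylor_norm x)%:C + (taylor_norm y)%:C.
Proof.
rewrite -rmorphD/= lecR; apply: taylor_lub => u u1.
by rewrite scalerDr (le_trans (ler_normD _ _))// lerD// taylor_ub.
Qed.

Lemma taylor_norm_ge (z : XC) :
  `|z.1| <= taylor_norm z /\ `|z.2| <= taylor_norm z.
Proof.
split.
  have : `|((1 : R[i]) *: z : XC).1| <= taylor_norm z by rewrite taylor_ub// normr1.
  by rewrite scale1r.
have : `|('i%C *: z : XC).1| <= taylor_norm z.
  by rewrite taylor_ub// normc_def/= expr0n/= add0r expr1n sqrtr1.
by rewrite /= scale0r scale1r sub0r normrN.
Qed.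

Lemma taylor_norm_le (z : XC) : taylor_norm z <= `|z.1| + `|z.2|.
Proof.
apply: taylor_lub => u u1.
exact: taylor_bound.
Qed.

Lemma taylor_norm_eq0 (z : XC) : (taylor_norm z)%:C = 0 -> z = 0.
Proof.
move=> /complexI z0; have [] := taylor_norm_ge z; rewrite z0 !normr_le0.
by case: z {z0} => x y /= /eqP -> /eqP ->.
Qed.

HB.instance Definition _ := Lmodule_isNormed.Build R[i] XC
  taylor_normD taylor_normZ taylor_norm_eq0.

Lemma cplx_normE (z : XC) : `|z| = (taylor_norm z)%:C.
Proof. by []. Qed.

Lemma cplx_norm_real (a : R) (z : XC) : `|z| < a%:C -> `|z.1| < a /\ `|z.2| < a.
Proof.
rewrite cplx_normE ltcR => za; have [z1 z2] := taylor_norm_ge z.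
by split; exact: le_lt_trans za.
Qed.

End Complexification.

Section CompleteComplexification.
Variables (R : realType) (X : completeNormedModType R).
Local Notation XC := (complexification X).

Lemma cplx_complete (F : set_system XC) : ProperFilter F -> cauchy F -> cvg F.
Proof.
move=> FF /cauchy_ballP Fc.
have Fc1 (e : R) : 0 < e -> \forall z \near F & w \near F,
    `|z.1 - w.1| < e /\ `|z.2 - w.2| < e.
  move=> e0; have e0' : 0 < e%:C by rewrite ltcR.
  apply: filterS (Fc _ e0') => -[z w] /=.
  by rewrite -ball_normE => /cplx_norm_real.
have c1 : cvg ((fun z : XC => z.1) @ F).
  apply/cauchy_cvgP/cauchy_ballP => e e0.
  rewrite near_map2.
  apply: filterS (Fc1 _ e0) => -[z w] /= [zw _].
  by rewrite -ball_normE.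
have c2 : cvg ((fun z : XC => z.2) @ F).
  apply/cauchy_cvgP/cauchy_ballP => e e0.
  rewrite near_map2.
  apply: filterS (Fc1 _ e0) => -[z w] /= [_ zw].
  by rewrite -ball_normE.
move: c1 c2 => /cvg_ex[/= x Fx] /cvg_ex[/= y Fy].
apply/cvg_ex; exists ((x, y) : XC); apply/cvgrPdist_lt => /= e e0.
have [e' e'E] : exists e', e = e'%:C.
  by apply/complex_realP; rewrite gtr0_real.
move: e0; rewrite e'E ltcR => e'0; have e'20 : 0 < e' / 2 by rewrite divr_gt0.
move/cvgrPdist_lt : Fx => /(_ _ e'20) Fx.
move/cvgrPdist_lt : Fy => /(_ _ e'20) Fy.
near=> z; rewrite cplx_normE ltcR (le_lt_trans (taylor_norm_le _))//.
by rewrite [ltRHS]splitr ltrD//=; near: z.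
Unshelve. all: by end_near. Qed.

HB.instance Definition _ := Uniform_isComplete.Build XC cplx_complete.

End CompleteComplexification.

Section ComplexifiedOperator.
Variables (R : realType) (X : completeNormedModType R).
Local Notation XC := (complexification X).
Implicit Types (A : linop X) (C : set X).

Section Extension.
Variable A : linop X.

Let domC : set XC := [set z | dom A z.1 /\ dom A z.2].
Let opC (z : XC) : XC := (A z.1, A z.2).

Let dom_comb a b x y : dom A x -> dom A y -> dom A (a *: x + b *: y).
Proof.
move=> Ax Ay; apply: dom_linear => //.
by rewrite -[b *: y]addr0; apply: dom_linear => //; exact: dom0.
Qed.

Let op_comb a b x y : dom A x -> dom A y ->
  A (a *: x + b *: y) = a *: A x + b *: A y.
Proof.
move=> Ax Ay.
have A0 : A 0 = 0.
  have := op_linear 1 (dom0 A) (dom0 A); rewrite !scale1r addr0.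
  by move/eqP; rewrite -subr_eq subrr => /eqP.
have By : dom A (b *: y).
  by rewrite -[b *: y]addr0; apply: dom_linear => //; exact: dom0.
rewrite op_linear//; congr (_ + _).
by rewrite -[b *: y]addr0 op_linear ?A0 ?addr0//; exact: dom0.
Qed.

Let domC0 : domC 0.
Proof. by split; exact: dom0. Qed.

Let domC_linear (l : R[i]) z w : domC z -> domC w -> domC (l *: z + w).
Proof.
move=> [z1 z2] [w1 w2]; split => /=; rewrite -[X in _ + X]scale1r.
  by rewrite -[_ - _]scale1r -scaleNr; do 2!apply: dom_comb => //.
by rewrite -[_ *: _ + _ *: _]scale1r; do 2!apply: dom_comb => //.
Qed.

Let opC_linear (l : R[i]) z w : domC z -> domC w ->
  opC (l *: z + w) = l *: opC z + opC w.
Proof.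
move=> [z1 z2] [w1 w2]; rewrite /opC/=; congr pair => /=.
  rewrite -[X in A (_ + X)]scale1r -[_ - _]scale1r -scaleNr op_comb//.
    by rewrite !scale1r op_comb// scaleNr.
  exact: dom_comb.
rewrite -[X in A (_ + X)]scale1r -[X in A (X + _)]scale1r op_comb//.
  by rewrite !scale1r op_comb.
exact: dom_comb.
Qed.

(* the canonical extension A (x + i y) = A x + i A y *)
Definition complexify : linop XC := Linop domC0 domC_linear opC_linear.

End Extension.

Definition spectral_bound A : \bar R :=
  ereal_sup [set (complex.Re l)%:E | l in spectrum (complexify A)].

Definition essential_spectral_bound A : \bar R :=
  ereal_sup [set (complex.Re l)%:E | l in essential_spectrum (complexify A)].

(* For real l in the resolvent set of the extension, the resolvent of the
   extension restricts to [resolvent A l] on X; hence the latter is used in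
   positivity statements. *)
Lemma resolvent_complexify A (l : R) (x : X) :
  resolvent_set (complexify A) l%:C ->
  resolvent (complexify A) l%:C ((x, 0) : XC) = (resolvent A l x, 0).
Proof.
move=> [[_ Cinj Csurj] _].
have shiftC (z : XC) :
    shift_op (complexify A) l%:C z = (shift_op A l z.1, shift_op A l z.2).
  by rewrite /=; congr pair; rewrite /= scale0r ?subr0 ?addr0.
have A_inj : {in dom A &, injective (shift_op A l)}.
  move=> u v /set_mem Au /set_mem Av uv.
  have A0 := dom0 A.
  suff /(congr1 fst) : ((u, 0) : XC) = (v, 0) by [].
  apply: Cinj; rewrite ?inE//; rewrite (shiftC (u, 0)) (shiftC (v, 0)).
  by congr pair.
have [[w1 w2] [Aw1 Aw2] wx] := Csurj ((x, 0) : XC) I.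
have [w1x w20] : shift_op A l w1 = x /\ shift_op A l w2 = 0.
  by move: wx; rewrite shiftC => -[].
have A0 : shift_op A l 0 = 0.
  have := op_linear 1 (dom0 (shift_op A l)) (dom0 (shift_op A l)).
  by rewrite !scale1r addr0 => /eqP; rewrite -subr_eq subrr => /eqP.
have w2E : w2 = 0.
  by apply: A_inj; rewrite ?inE ?w20 ?A0//; exact: dom0.
rewrite -wx /resolvent pinvKV//; last by rewrite inE.
by rewrite w2E -w1x pinvKV// inE.
Qed.

Definition resolvent_positive C A : Prop :=
  exists omega : R, forall l : R, omega < l ->
    resolvent_set (complexify A) l%:C /\ positive_op C (resolvent A l).

End ComplexifiedOperator.

(* Main.v *)
From HB Require Import structures.
Require Import Defs.
From mathcomp Require Import all_boot all_order all_algebra.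
From mathcomp Require Import complex ring lra.
From mathcomp Require Import all_classical all_reals all_analysis.

(** Only the implications from (i) to (ii) and from (iv) to (i) need an idea;
    (ii) gives (iii) on applying the positive operator R(0) to A x, and (iii)
    gives (iv) because the cone is pointed. Write R(l) for the resolvent of
    (the complexification of) A at l.

    Positivity propagates along resolvents. If R(m) is positive and l < m is so
    close to m that (m - l) R(m) is a contraction, then w = R(l) x solves
    w = R(m) x + (m - l) R(m) w, hence is the limit of an iteration that stays
    in the closed cone. A supremum argument carries positivity down any real
    interval free of spectrum, which gives (ii) from (i). The same argument
    (propagate_positive) applies to other families that satisfy such an
    identity. Run on pairs, it shows (resolvent_dominated) that along the two
    paths m - s e and m - s, with |e| = 1 and s growing,
    R(m - s) x - Re (c R(m - s e) x) stays in the cone for x in the cone and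
    |c| = 1, as long as neither path meets the spectrum.
    This plays the role of the estimate |R(l) x| <= R(Re l) |x| known from
    Banach lattices.

    For (iv) implies (i), the Fredholm hypothesis enters through
    resolvent_blowup. Let l tend to a spectral point l0 at which l0 - A is
    Fredholm, through regular points. The norms b of R(l) tend to infinity, and
    the vectors y for which R(l) y / b tends to 0 form a closed subspace that
    contains the range of l0 - A. It cannot be everything: that range has
    finite codimension, so by the open mapping theorem convergence to 0 on
    finitely many more vectors would force convergence in norm, but R(l) / b
    has norm one. As the cone is total, some x in the cone is therefore
    outside of this subspace, and R(l) x / b accumulates at a nonzero
    eigenvector for l0, because the kernel has finite dimension and the range
    is closed. Limits are taken along an ultrafilter, which avoids the
    extraction of subsequences.

    Suppose (iv). If some t >= 0 is in the spectrum, let s be the largest real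
    spectral point. For real l decreasing to s the vectors R(l) x / b are in the
    cone, and so is the eigenvector that they produce (positive_eigenvector);
    as A v = s v with s >= 0, this contradicts (iv). So all reals above some
    negative a are regular. If there were a spectral point l' with real part
    above a, consider a large real m and the first spectral point l0 on the
    segment from m to l'. The vectors R(l) x / b converge along the segment to
    an eigenvector v for l0, and they are dominated by R(t) x / b for real t in
    a compact interval of regular points, which tends to 0. So - Re (c v) is in
    the cone for every c with |c| = 1, and v = 0, since the cone is pointed, a
    contradiction (half_plane_resolvent). *)

Set Implicit Arguments.
Unset Strict Implicit.
Unset Printing Implicit Defensive.

Import Order.TTheory GRing.Theory Num.Theory.
Import numFieldNormedType.Exports.

Local Open Scope classical_set_scope.
Local Open Scope ring_scope.

(** * Finite-dimensional subspaces of a normed space *)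

(** Pairs and coordinate rows have to be Banach spaces, as the open mapping
    theorem is applied to a map from a product of such spaces. *)
HB.instance Definition _ (R : realType) m n := Complete.on 'M[R]_(m, n).

Lemma prod_complete (K : numFieldType) (X Y : completeNormedModType K)
    (XY := [the normedModType K of (X * Y)%type]) (F : set_system XY) :
  ProperFilter F -> cauchy F -> cvg F.
Proof.
move=> FF /cauchy_ballP Fc.
have c1 : cvg ((fun z : XY => z.1) @ F).
  apply/cauchy_cvgP/cauchy_ballP => e e0.
  by rewrite near_map2; apply: filterS (Fc _ e0) => -[[a b] [c d]] [].
have c2 : cvg ((fun z : XY => z.2) @ F).
  apply/cauchy_cvgP/cauchy_ballP => e e0.
  by rewrite near_map2; apply: filterS (Fc _ e0) => -[[a b] [c d]] [].
move: c1 c2 => /cvg_ex[/= x Fx] /cvg_ex[/= y Fy].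
have Fid : (fun z : XY => (z.1, z.2)) = id by apply/funext => -[].
have := cvg_pair Fx Fy; rewrite Fid => Fxy.
have H : F --> ((x, y) : XY) by exact: Fxy.
exact (@cvgP XY F (x, y) H).
Qed.

HB.instance Definition _ (K : numFieldType) (X Y : completeNormedModType K) :=
  Uniform_isComplete.Build (X * Y)%type (@prod_complete K X Y).

Lemma bounded_linear_continuous_at (R : realType) (V W : normedModType R)
    (f : V -> W) (M : R) :
  linear f -> (forall x, `|f x| <= M * `|x|) -> continuous f.
Proof.
move=> lf fM; pose f' : {linear V -> W} :=
  HB.pack f (GRing.isLinear.Build _ _ _ _ _ lf).
apply: (@bounded_linear_continuous _ _ _ f').
apply/linear_boundedP; near=> r => w.
by rewrite (le_trans (fM w))// ler_wpM2r.
Unshelve. all: by end_near. Qed.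

Definition lincomb (R : realType) (Y : normedModType R) (k : nat)
  (f : 'I_k -> Y) (a : 'rV[R]_k) : Y := \sum_i a 0 i *: f i.

Definition is_subspace (R : realType) (Y : normedModType R) (S : set Y) :=
  S 0 /\ forall (t : R) x y, S x -> S y -> S (t *: x + y).

Section FiniteDimension.
Context {R : realType} {Y : normedModType R}.
Implicit Types (S : set Y).

Lemma lincombP k (f : 'I_k -> Y) : linear (lincomb f).
Proof.
move=> t a b; rewrite /lincomb scaler_sumr -big_split/=.
by apply: eq_bigr => i _; rewrite !mxE scalerDl scalerA.
Qed.

HB.instance Definition _ k (f : 'I_k -> Y) :=
  GRing.isLinear.Build R 'rV[R]_k Y _ (lincomb f) (lincombP f).

Lemma row_coord_le k (a : 'rV[R]_k) i : `|a 0 i| <= `|a|.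
Proof.
rewrite [leRHS]/Num.norm/= mx_normrE.
exact: (le_bigmax _ (fun ij : 'I_1 * 'I_k => `|a ij.1 ij.2|) (0, i)).
Qed.

Lemma lincomb_bounded k (f : 'I_k -> Y) a :
  `|lincomb f a| <= (\sum_i `|f i|) * `|a|.
Proof.
rewrite mulr_suml (le_trans (ler_norm_sum _ _ _))//.
by apply: ler_sum => i _; rewrite normrZ mulrC ler_wpM2l// row_coord_le.
Qed.

Lemma lincomb_continuous k (f : 'I_k -> Y) : continuous (lincomb f).
Proof.
exact: (bounded_linear_continuous_at (@lincombP k f) (lincomb_bounded f)).
Qed.

Lemma subspaceB S x y : is_subspace S -> S x -> S y -> S (x - y).
Proof. by move=> [_ Sl] Sx Sy; rewrite addrC -scaleN1r; apply: Sl. Qed.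

Lemma subspaceZ S t x : is_subspace S -> S x -> S (t *: x).
Proof. by move=> [S0 Sl] Sx; rewrite -[_ *: _]addr0; apply: Sl. Qed.

(** With S = 0 this extracts a basis, and with S the range of an operator it
    extracts a basis of an algebraic complement: as long as some combination
    of the family falls into S, one of its vectors can be dropped. *)
Lemma indep_mod_subspace S : is_subspace S -> forall k (f : 'I_k -> Y),
  exists m (g : 'I_m -> Y),
    (forall y, (exists a, S (y - lincomb f a)) -> exists b, S (y - lincomb g b))
    /\ (forall b, S (lincomb g b) -> b = 0).
Proof.
move=> Sl; elim=> [|k IH] f.
  exists 0%N, f; split=> // b _; apply/rowP; case=> //.
have [[c [c0 Sc]]|nc] := pselect (exists c, c != 0 /\ S (lincomb f c)); last first.
  exists k.+1, f; split=> // b Sb.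
  by apply/eqP/negP => /negP b0; apply: nc; exists b.
have [j cj] : exists j, c 0 j != 0.
  apply/not_existsP => nj; move/eqP: c0; apply; apply/rowP => j.
  by rewrite mxE; apply/eqP/negP => /negP; exact: nj.
have [m [g [gs gi]]] := IH (f \o lift j); exists m, g; split=> // y [a Sa].
apply: gs; pose d := a - (a 0 j / c 0 j) *: c.
exists (\row_i d 0 (lift j i)).
have -> : lincomb (f \o lift j) (\row_i d 0 (lift j i)) = lincomb f d.
  rewrite /lincomb [RHS](bigD1_ord j)//= {1}/d !mxE divfK// subrr scale0r add0r.
  by apply: eq_bigr => i _; rewrite !mxE.
rewrite /d linearB/= opprB addrCA addrC addrC linearZ/=.
by case: Sl => _; apply.
Qed.

(** A continuous function that does not vanish on the unit sphere of the
    coordinate space is bounded below there by compactness. *)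
Lemma indep_lower_bound k (g : 'I_k -> Y) :
  (forall b, lincomb g b = 0 -> b = 0) ->
  exists2 d : R, 0 < d & forall b, d * `|b| <= `|lincomb g b|.
Proof.
move=> gi; pose S := [set b : 'rV[R]_k | `|b| = 1].
have [[b0 Sb0]|nS] := pselect (S !=set0); last first.
  exists 1 => // b; suff -> : b = 0 by rewrite normr0 mulr0.
  apply/eqP/negP => /negP b0; apply: nS; exists (`|b|^-1 *: b).
  by rewrite /S/= normrZ normfV normr_id mulVf// normr_eq0.
have cS : compact S.
  apply: bounded_closed_compact; first by exists 1; split=> // x x1 y/= ->; exact: ltW.
  apply: (@closed_comp _ _ (fun b : 'rV[R]_k => `|b|) [set 1]).
    by move=> x _; exact: norm_continuous.
  exact: closed_eq.
have [c cS1 cm] : exists2 c, c \in S & forall t, t \in S -> `|lincomb g c| <= `|lincomb g t|.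
  apply: (@EVT_min_rV _ _ (fun b => `|lincomb g b|)) => //; first by exists b0.
  apply: continuous_subspaceT => x; apply: continuous_comp.
    exact: lincomb_continuous.
  exact: norm_continuous.
exists `|lincomb g c|.
  rewrite normr_gt0; apply/negP => /eqP /gi c0.
  by move: cS1; rewrite inE /S/= c0 normr0 => /esym/eqP; rewrite oner_eq0.
move=> b; have [->|bn0] := eqVneq b 0; first by rewrite normr0 mulr0.
have nb0 : 0 < `|b| by rewrite normr_gt0.
have : `|lincomb g c| <= `|lincomb g (`|b|^-1 *: b)|.
  by apply: cm; rewrite inE /S/= normrZ normfV normr_id mulVf// gt_eqF.
by rewrite linearZ/= normrZ normfV normr_id mulrC ler_pdivlMr.
Qed.

(** The Bolzano-Weierstrass theorem, with an ultrafilter in place of a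
    subsequence: the coordinates of v in a basis stay in a compact ball. *)
Lemma finite_dim_ultra_cvg (I : Type) (F : set_system I) (M : R) (v : I -> Y) k
    (f : 'I_k -> Y) : UltraFilter F ->
  (\forall i \near F, `|v i| <= M) -> (\forall i \near F, exists a, v i = lincomb f a) ->
  exists w : Y, v i @[i --> F] --> w.
Proof.
move=> FU vM vf.
have S0l : is_subspace [set (0 : Y)].
  by split=> // t x y -> ->; rewrite scaler0 addr0.
have [m [g [gs gi]]] := indep_mod_subspace S0l f.
have [d d0 gd] := indep_lower_bound gi.
have FP : ProperFilter F := ultra_proper.
have vg : \forall i \near F, exists b, v i = lincomb g b.
  apply: filterS vf => i [a va].
  have [|b /eqP] := gs (v i); first by exists a; rewrite va subrr.
  by rewrite subr_eq0 => /eqP; exists b.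
have /choice[b bE] : forall i, exists b, (exists b', v i = lincomb g b') -> v i = lincomb g b.
  move=> i; have [[b vb]|nb] := pselect (exists b', v i = lincomb g b'); last by exists 0.
  by exists b.
pose D := [set x : 'rV[R]_m | `|x| <= M / d].
have cD : compact D.
  apply: bounded_closed_compact.
    by exists (M / d); split=> [|x x1 y/= /le_trans]; [exact: num_real|apply; exact: ltW].
  apply: (@closed_comp _ _ (fun b : 'rV[R]_m => `|b|) [set x | x <= M / d]).
    by move=> x _; exact: norm_continuous.
  exact: closed_le.
have bD : (b @ F) D.
  apply: filterS2 vM vg => i vi /bE vb.
  by rewrite /D/= ler_pdivlMr// mulrC (le_trans (gd _))// -vb.
have bU : UltraFilter (b @ F).
  split; first exact: fmap_proper_filter.
  move=> G GP sG; apply/seteqP; split=> // A GA.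
  have [//|FA] := in_ultra_setVsetC (b @^-1` A) FU.
  have : G (A `&` ~` A) by apply: filterI => //; exact: sG.
  by rewrite setICr => /filter_not_empty.
move: cD; rewrite compact_ultra => /(_ _ bU bD)[p [_ bp]].
exists (lincomb g p).
apply: (@cvg_trans _ ((lincomb g \o b) @ F)).
  apply: near_eq_cvg; apply: filterS vg => i /bE/= -> //.
apply: continuous_cvg => //; exact: lincomb_continuous.
Qed.

End FiniteDimension.

(** * The open mapping theorem *)

Section OpenMapping.
Context {R : realType} {W Y : completeNormedModType R}.
Variables (f : {linear W -> Y}) (M : R).
Hypothesis fM : forall w, `|f w| <= M * `|w|.
Hypothesis fsurj : forall y, exists w, f w = y.

(* By Baire, the closure of the image of some ball of radius n contains a ball
   B(y0, r). A vector of norm at most r / 2 is the difference of two points of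
   that ball, hence almost the image of a vector of norm at most 2 n. *)
Let almost_open : exists2 c : R, 0 < c & forall y (e : R), 0 < e ->
  exists2 w, `|w| <= c * `|y| & `|y - f w| < e.
Proof.
pose B n := closure [set f w | w in [set w | `|w| <= n%:R]].
have [n nB] : exists n, ~ dense (~` B n).
  apply/not_existsP => Bd.
  have : dense (\bigcap_n ~` B n).
    apply: Baire => n; split; first exact/closed_openC/closed_closure.
    by have := Bd n; apply: contra_notP.
  move=> /(_ setT) [ | |y [_ yB]]; [by exists 0|exact: openT|].
  have [w wy] := fsurj y.
  apply: (yB (Num.truncn `|w|).+1 I); apply: subset_closure; exists w => //=.
  exact/ltW/Num.Theory.truncnS_gt.
have [V [[y0 [Vo Vy0]] VB]] := denseNE nB.
have [r /= r0 yB] : exists2 r : R, 0 < r & ball y0 r `<=` B n.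
  have /nbhs_ballP[r r0 yV] : nbhs y0 V by exact: open_nbhs_nbhs.
  exists r => // y /yV Vy; apply: contrapT => nBy.
  by have : (V `&` ~` B n) y by []; rewrite VB.
have Bapp y (e : R) : 0 < e -> B n y -> exists2 w, `|w| <= n%:R & `|y - f w| < e.
  move=> e0 /(_ (ball y e)) [|_ [[w wn <-] ye]]; first exact: nbhsx_ballx.
  by exists w => //; move: ye; rewrite -ball_normE.
exists (2 * n.+1%:R * 2 / r); first by rewrite divr_gt0// !mulr_gt0.
move=> y e e0; have [->|yn0] := eqVneq y 0.
  by exists 0; rewrite ?normr0 ?mulr0// linear0 subr0 normr0.
have ny0 : 0 < `|y| by rewrite normr_gt0.
(* Rescale y to norm r / 2. *)
pose t := r / 2 / `|y|; have t0 : 0 < t by rewrite !divr_gt0.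
have et0 : 0 < e * t / 2 by rewrite divr_gt0// mulr_gt0.
have [|w1 w1n w1y] := Bapp (y0 + t *: y) _ et0.
  apply: yB; rewrite -ball_normE/= opprD addNKr normrN normrZ gtr0_norm//.
  by rewrite /t divfK ?gt_eqF// ltr_pdivrMr// ltr_pMr// ltr1n.
have [|w0 w0n w0y] := Bapp y0 _ et0; first by apply: yB; exact: ballxx.
exists (t^-1 *: (w1 - w0)).
  rewrite normrZ gtr0_norm ?invr_gt0//.
  have -> : 2 * n.+1%:R * 2 / r * `|y| = t^-1 * (2 * n.+1%:R).
    by rewrite /t; field; rewrite !gt_eqF.
  apply: ler_wpM2l; first by rewrite invr_ge0 ltW.
  rewrite (le_trans (ler_normB _ _))// mulr_natl mulr2n.
  have n1 : n%:R <= n.+1%:R :> R by rewrite ler_nat.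
  by rewrite lerD// ?(le_trans w1n)// (le_trans w0n).
have -> : y - f (t^-1 *: (w1 - w0)) =
    t^-1 *: ((y0 + t *: y - f w1) - (y0 - f w0)).
  rewrite linearZ/= linearB/= -[X in X - _]scale1r -(mulVf (lt0r_neq0 t0)).
  rewrite -scalerA -scalerBr; congr (_ *: _).
  by rewrite !opprD !opprK [RHS]addrACA (addrC y0) addrK addrC.
rewrite normrZ gtr0_norm ?invr_gt0// mulrC ltr_pdivrMr//.
rewrite (le_lt_trans (ler_normB _ _))// [ltRHS]splitr ltrD//.
Qed.


(** Solve f w = y up to half of the norm of y, and repeat with the remainder:
    the corrections form a series dominated by a geometric one. *)
Theorem open_mapping : exists2 c : R, 0 < c &
  forall y, exists2 w, f w = y & `|w| <= c * `|y|.
Proof.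
have [c c0 fc] := almost_open.
have /choice[g gE] : forall y, exists w,
    `|w| <= c * `|y| /\ `|y - f w| <= 2^-1 * `|y|.
  move=> y; have [->|y0] := eqVneq y 0.
    by exists 0; rewrite linear0 subrr !normr0 !mulr0.
  have [|w wy yw] := fc y (2^-1 * `|y|); first by rewrite mulr_gt0// normr_gt0.
  by exists w; split=> //; exact: ltW.
exists (2 * c) => [|y]; first by rewrite mulr_gt0.
pose z n := iter n (fun u => u - f (g u)) y.
have zn n : `|z n| <= geometric `|y| 2^-1 n.
  elim: n => [|n IH]; first by rewrite /= expr0 mulr1.
  rewrite (le_trans (gE _).2)//= exprS mulrCA ler_wpM2l//.
have gz n : `|g (z n)| <= geometric (c * `|y|) 2^-1 n.
  by rewrite (le_trans (gE _).1)//= -mulrA ler_wpM2l// ltW.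
have half1 : `|2^-1 : R| < 1 by rewrite gtr0_norm// invf_lt1// ltr1n.
have cn : cvgn [normed series (fun n => g (z n))].
  apply: (series_le_cvg _ _ gz) => [n|n|]//.
    by rewrite /= !mulr_ge0// ?ltW.
  exact: is_cvg_geometric_series.
have cs := normed_cvg cn.
exists (limn (series (fun n => g (z n)))).
  have fs n : f (series (fun n => g (z n)) n) = y - z n.
    elim: n => [|n IH]; first by rewrite /series/= big_geq// linear0 subrr.
    by rewrite seriesSr linearD/= IH /= opprB addrA addrAC.
  have fc' : continuous f.
    by apply: (bounded_linear_continuous_at _ fM); exact: linearP.
  have z0 : z n @[n --> \oo] --> (0 : Y).
    apply/norm_cvg0P; apply: (@squeeze_cvgr _ _ _ _ (fun=> 0) (geometric `|y| 2^-1)).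
    - by apply: nearW => n; rewrite normr_ge0 zn.
    - exact: cvg_cst.
    - exact: cvg_geometric.
  have : f (series (fun n => g (z n)) n) @[n --> \oo] --> y.
    rewrite (_ : (fun _ => _) = (fun n => y - z n)); last exact/funext.
    by rewrite -[X in _ --> X]subr0; apply: cvgB => //; exact: cvg_cst.
  apply: cvg_unique => //.
  by apply: continuous_cvg => //; exact: fc'.
have -> : 2 * c * `|y| = c * `|y| / (1 - 2^-1) by field.
rewrite -(cvg_lim _ (cvg_geometric_series half1))//.
rewrite (le_trans (lim_series_norm cn))//.
exact: (lim_series_le cn (is_cvg_geometric_series half1) gz).
Qed.

End OpenMapping.

(** * Operators with finite-dimensional kernel and finite-codimensional range *)

Lemma cvg_sumr0 (R : realType) (I J : Type) (F : set_system I) (r : seq J)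
    (h : J -> I -> R) : Filter F ->
  (forall j, h j i @[i --> F] --> 0) ->
  \sum_(j <- r) h j i @[i --> F] --> 0.
Proof.
move=> FF h0; elim: r => [|j r IH].
  by under eq_cvg do rewrite big_nil; exact: cvg_cst.
have -> : (fun i => \sum_(k <- j :: r) h k i) =
    (fun i => h j i + \sum_(k <- r) h k i).
  by apply/funext => i; rewrite big_cons.
by have := cvgD (h0 j) IH; rewrite addr0 => /(_ FF).
Qed.

(** Uniform boundedness makes the space of vectors on which the Q i tend to 0
    closed. *)
Lemma null_set_closed (R : realType) (Y : normedModType R) (I : Type)
    (F : set_system I) (Q : I -> Y -> Y) :
  ProperFilter F ->
  (\forall i \near F, linear (Q i) /\ forall y, `|Q i y| <= `|y|) ->
  is_subspace [set y | Q i y @[i --> F] --> (0 : Y)] /\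
  closed [set y | Q i y @[i --> F] --> (0 : Y)].
Proof.
move=> FF Qs; split.
  split=> [|a x y] /=.
    apply: (@cvg_trans _ ((fun=> 0 : Y) @ F)); last exact: cvg_cst.
    apply: near_eq_cvg; apply: filterS Qs => i [_ Qb].
    by apply/esym/eqP; rewrite -normr_le0 (le_trans (Qb 0))// normr0.
  move=> xE yE; apply: (@cvg_trans _ ((fun i => a *: Q i x + Q i y) @ F)).
    by apply: near_eq_cvg; apply: filterS Qs => i [-> _].
  have axE : a *: Q i x @[i --> F] --> a *: (0 : Y) by exact: cvgZl_tmp.
  by have := cvgD axE yE; rewrite scaler0 addr0; exact.
move=> y /= yE; apply/cvgrPdist_le => e e0.
have e2 : 0 < e / 2 by rewrite divr_gt0.
have [x [/= xE yx]] := yE _ (nbhsx_ballx y _ e2).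
have := @cvgr0_norm_le _ _ _ _ _ _ xE _ e2 => /(_ FF) xe.
apply: filterS2 Qs xe => i [Ql Qb] xe.
pose Q' : {linear Y -> Y} := HB.pack (Q i) (GRing.isLinear.Build _ _ _ _ _ Ql).
rewrite sub0r normrN -[y](subrK x) -[Q i _]/(Q' _) linearD/= [leRHS]splitr.
rewrite (le_trans (ler_normD _ _))// lerD//.
by rewrite (le_trans (Qb _))// ltW//; move: yx; rewrite -ball_normE.
Qed.

(** In this section B stands for l0 - A, T for the resolvent of A at some
    regular point m and kap for the multiplication by m - l0. The two
    identities below say that T inverts m - A = B + kap. Since T maps onto the
    domain, parametrizing the domain by T replaces its graph norm: B o T is
    a bounded operator with the same range as B. *)
Section Fredholm.
Context {R : realType} {Y : completeNormedModType R}.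
Variables (B : linop Y) (T kap : Y -> Y) (t c : R).
Hypotheses (t0 : 0 <= t) (c0 : 0 <= c).
Hypotheses (Tlin : linear T) (Tb : forall y, `|T y| <= t * `|y|).
Hypothesis kb : forall y, `|kap y| <= c * `|y|.
Hypothesis klin : linear kap.
Hypothesis TB : forall y, dom B (T y) /\ B (T y) = y - kap (T y).
Hypothesis BT : forall x, dom B x -> T (B x + kap x) = x.

Lemma linop0 : B 0 = 0.
Proof.
have := op_linear 1 (dom0 B) (dom0 B); rewrite !scale1r addr0.
by move/eqP; rewrite -subr_eq subrr => /eqP.
Qed.

Lemma subspace_dom : is_subspace (dom B).
Proof. by split=> [|a x y]; [exact: dom0|exact: dom_linear]. Qed.

Lemma linopB x y : dom B x -> dom B y -> B (x - y) = B x - B y.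
Proof. by move=> xB yB; rewrite addrC -scaleN1r op_linear// scaleN1r addrC. Qed.

Lemma linopZ a x : dom B x -> B (a *: x) = a *: B x.
Proof. by move=> xB; rewrite -[a *: x]addr0 op_linear ?linop0 ?addr0//; exact: dom0. Qed.

Lemma subspace_range : is_subspace [set B x | x in dom B].
Proof.
split; first by exists 0; [exact: dom0|exact: linop0].
move=> a _ _ [x xB <-] [y yB <-]; exists (a *: x + y); first exact: dom_linear.
exact: op_linear.
Qed.

(** Open mapping theorem for (z, a) |-> B (T z) + lincomb g a, where g spans a
    complement of the range: both parts of the decomposition of a vector are
    controlled by its norm. *)
Lemma fredholm_range k (f : 'I_k -> Y) :
  (forall y, exists a, [set B x | x in dom B] (y - lincomb f a)) ->
  exists (m : nat) (g : 'I_m -> Y) (d : R), [/\ 0 < d,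
    (forall a, [set B x | x in dom B] (lincomb g a) -> a = 0) &
    forall y, exists x a, [/\ dom B x, y = B x + lincomb g a,
      `|x| <= d * `|y| & `|a| <= d * `|y|]].
Proof.
move=> fB; have [m [g [gs gi]]] := indep_mod_subspace subspace_range f.
pose phi (z : Y * 'rV[R]_m) := B (T z.1) + lincomb g z.2.
have phil : linear phi.
  move=> a z w; rewrite /phi/= Tlin op_linear//; try exact: (TB _).1.
  by rewrite linearP/= addrACA scalerDr.
pose phiL : {linear (Y * 'rV[R]_m)%type -> Y} :=
  HB.pack phi (GRing.isLinear.Build _ _ _ _ _ phil).
pose M := 1 + c * t + \sum_i `|g i|.
have phib z : `|phiL z| <= M * `|z|.
  have z1 : `|z.1| <= `|z| by rewrite prod_normE le_max lexx.
  have z2 : `|z.2| <= `|z| by rewrite prod_normE le_max lexx orbT.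
  rewrite (le_trans (ler_normD _ _))// mulrDl lerD//; last first.
    by rewrite (le_trans (lincomb_bounded _ _))// ler_wpM2l// sumr_ge0.
  rewrite (TB _).2 (le_trans (ler_normB _ _))// mulrDl mul1r lerD//.
  by rewrite (le_trans (kb _))// -mulrA ler_wpM2l// (le_trans (Tb _))// ler_wpM2l.
have phis y : exists z, phiL z = y.
  have [|a [x xB xy]] := gs y; first exact: fB.
  exists (B x + kap x, a); rewrite /= /phi/= BT// xy.
  by rewrite addrNK.
have [d d0 dP] := open_mapping phib phis.
exists m, g, ((t + 1) * d); split=> // [|y]; first by rewrite mulr_gt0// ltr_wpDl.
have [[z a] zy zd] := dP y; exists (T z), a.
have z1 : `|z| <= d * `|y| by rewrite (le_trans _ zd)// prod_normE le_max lexx.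
have z2 : `|a| <= d * `|y| by rewrite (le_trans _ zd)// prod_normE le_max lexx orbT.
split=> //; first exact: (TB _).1.
- rewrite (le_trans (Tb _))// -mulrA; apply: ler_pM => //.
  by rewrite lerDl.
- by rewrite (le_trans z2)// -mulrA ler_peMl ?(le_trans _ z2)// lerDr.
Qed.

(** B itself may be unbounded, but on its kernel the identity is T o kap, which
    is bounded. *)
Lemma kernel_closed (I : Type) (F : set_system I) (v : I -> Y) (w : Y) :
  ProperFilter F ->
  (\forall i \near F, dom B (v i) /\ B (v i) = 0) -> v i @[i --> F] --> w ->
  dom B w /\ B w = 0.
Proof.
move=> FF vB vw.
have Tc := bounded_linear_continuous_at Tlin Tb.
have kc := bounded_linear_continuous_at klin kb.
have wE : T (kap w) = w.
  apply: (cvg_unique _ _ vw) => //.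
  apply: (@cvg_trans _ ((fun i => T (kap (v i))) @ F)).
    apply: near_eq_cvg; apply: filterS vB => i [vD v0].
    by rewrite -[kap _]add0r -v0 BT.
  apply: continuous_cvg; first exact: Tc.
  by apply: continuous_cvg => //; exact: kc.
have [wD Bw] := TB (kap w); rewrite -wE; split=> //.
by rewrite Bw wE subrr.
Qed.

(** If B v tends to 0, then fredholm_range gives preimages x of B v that tend
    to 0, and v - x moves in the finite-dimensional kernel. *)
Lemma fredholm_ultra_cvg (I : Type) (F : set_system I) (M : R) (v : I -> Y)
    k (f : 'I_k -> Y) m (g : 'I_m -> Y) :
  (forall y, exists a, [set B x | x in dom B] (y - lincomb f a)) ->
  (forall x, dom B x -> B x = 0 -> exists a, x = lincomb g a) ->
  UltraFilter F -> (\forall i \near F, `|v i| <= M) ->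
  (\forall i \near F, dom B (v i)) -> B (v i) @[i --> F] --> (0 : Y) ->
  exists w, [/\ dom B w, B w = 0 & v i @[i --> F] --> w].
Proof.
move=> fB gB FU vM vD Bv0; have FP : ProperFilter F by exact: ultra_proper.
have [n [h [d [d0 hi hB]]]] := fredholm_range fB.
have /choice[x xP] : forall i, exists x, dom B (v i) ->
    [/\ dom B x, B x = B (v i) & `|x| <= d * `|B (v i)|].
  move=> i; have [vi|nvi] := pselect (dom B (v i)); last by exists 0.
  have [x [a [xD xE xd _]]] := hB (B (v i)).
  exists x => _; split=> //; rewrite xE [a]hi ?linear0 ?addr0//.
  exists (v i - x); first exact: subspaceB subspace_dom _ _.
  by rewrite linopB// xE addrC addKr.
have x0 : x i @[i --> F] --> (0 : Y).
  apply/norm_cvg0P; apply: (@squeeze_cvgr _ _ _ _ (fun=> 0) (fun i => d * `|B (v i)|)).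
  - by apply: filterS vD => i /xP[_ _ ->]; rewrite normr_ge0.
  - exact: cvg_cst.
  - by rewrite -(mulr0 d); apply: cvgMl_tmp; apply/norm_cvg0P.
have xM : \forall i \near F, `|x i| <= 1.
  have := @cvgr0_norm_le _ _ _ _ _ _ x0 1 ltr01; exact.
have [w vxw] : exists w : Y, v i - x i @[i --> F] --> w.
  apply: (@finite_dim_ultra_cvg _ _ _ _ (M + 1) _ _ g) => //.
    by apply: filterS2 vM xM => i vM xM; rewrite (le_trans (ler_normB _ _))// lerD.
  apply: filterS vD => i vi; have [xD xB _] := xP _ vi.
  by apply: gB; [exact: subspaceB subspace_dom _ _|rewrite linopB// xB subrr].
have vw : v i @[i --> F] --> w.
  rewrite -[w]addr0; rewrite (_ : v = (fun i => (v i - x i) + x i)).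
    exact: cvgD.
  by apply/funext => i; rewrite addrNK.
exists w; have [|] := kernel_closed FP _ vxw; last by [].
apply: filterS vD => i vi; have [xD xB _] := xP _ vi.
by split; [exact: subspaceB subspace_dom _ _|rewrite linopB// xB subrr].
Qed.

(** Here Q i stands for the resolvent at a point l i tending to l0 and eta i for
    the multiplication by l i - l0. Split a unit vector x on which Q i almost
    attains its norm as x = B u + lincomb g a. Then Q i (B u) = u - Q i (eta i u)
    is negligible with respect to b i, and Q i (lincomb g a) is as well if
    Q i / b i tends to 0 on the finitely many vectors g j. *)
Lemma fredholm_blowup (I : Type) (F : set_system I) (Q eta : I -> Y -> Y)
    (b s : I -> R) k (f : 'I_k -> Y) :
  (forall y, exists a, [set B x | x in dom B] (y - lincomb f a)) ->
  ProperFilter F ->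
  (\forall i \near F, [/\ linear (Q i), 0 < b i,
     forall y, `|Q i y| <= b i * `|y|,
     exists2 x, `|x| <= 1 & b i / 2 <= `|Q i x| &
     [/\ 0 <= s i, forall y, `|eta i y| <= s i * `|y| &
       forall x, dom B x -> Q i (B x + eta i x) = x]]) ->
  s i @[i --> F] --> 0 -> (b i)^-1 @[i --> F] --> 0 ->
  ~ (forall y, (b i)^-1 *: Q i y @[i --> F] --> (0 : Y)).
Proof.
move=> fB FP Qs s0 b0 Q0.
have [n [g [d [d0 gi gB]]]] := fredholm_range fB.
(* h i bounds the norm of Q i x / b i, which is at least 1 / 2. *)
pose h i := ((b i)^-1 + s i + \sum_j `|(b i)^-1 *: Q i (g j)|) * d.
have h0 : h i @[i --> F] --> 0.
  rewrite -[X in _ --> X](mul0r d); apply: cvgMr_tmp.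
  rewrite -[X in _ --> X]addr0; apply: cvgD.
    by rewrite -[X in _ --> X]addr0; apply: cvgD.
  by apply: cvg_sumr0 => j; apply/norm_cvg0P.
suff : (2^-1 : R) <= 0 by rewrite invr_le0 leNgt ltr0n.
apply: (cvgr_to_ge h0); apply: filterS Qs => i.
case=> Ql bp Qb [x x1 Qx] [si eb Qe].
pose Q' : {linear Y -> Y} := HB.pack (Q i) (GRing.isLinear.Build _ _ _ _ _ Ql).
have [u [a [uD xE ud ad]]] := gB x.
have dx : d * `|x| <= d by rewrite ler_piMr// ltW.
have {ud}ud : `|u| <= d := le_trans ud dx.
have {ad}ad : `|a| <= d := le_trans ad dx.
have QB : Q i (B u) = u - Q i (eta i u).
  by rewrite -[X in X - _](Qe _ uD) -[RHS](linearB Q') addrK.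
have bV : 0 <= (b i)^-1 by rewrite invr_ge0 ltW.
have : (b i)^-1 * `|Q i x| <= h i.
  rewrite xE -[Q i _]/(Q' _) linearD/= QB.
  rewrite (le_trans (ler_wpM2l bV (ler_normD _ _)))// mulrDr /h mulrDl lerD//.
    rewrite (le_trans (ler_wpM2l bV (ler_normB _ _)))// mulrDr mulrDl lerD//.
      exact: ler_wpM2l.
    rewrite (le_trans (ler_wpM2l bV (Qb _)))// mulKf ?gt_eqF//.
    by rewrite (le_trans (eb _))// ler_wpM2l.
  rewrite -[X in X * _](ger0_norm bV) -normrZ -[Q i _]/(Q' _) linear_sum scaler_sumr.
  rewrite (le_trans (ler_norm_sum _ _ _))// mulr_suml ler_sum// => j _.
  rewrite [Q' _]linearZ/= scalerA mulrC -scalerA normrZ mulrC ler_wpM2l//.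
  by rewrite (le_trans (row_coord_le _ _)).
by apply: le_trans; rewrite mulrC ler_pdivlMr// mulrC.
Qed.

End Fredholm.

(** * Resolvents, and the complexification as a real Banach space *)

Section Resolvent.
Context {K : numFieldType} {V : normedModType K}.
Variable B : linop V.
Implicit Types l m : K.

Lemma resolventP l y : resolvent_set B l ->
  dom B (resolvent B l y) /\ l *: resolvent B l y - B (resolvent B l y) = y.
Proof.
move=> [[_ Binj Bsurj] _].
have [x xB xy] := Bsurj y I.
suff -> : resolvent B l y = x by [].
by rewrite -xy /resolvent pinvKV// inE.
Qed.

Lemma resolventK l x : resolvent_set B l -> dom B x ->
  resolvent B l (l *: x - B x) = x.
Proof.
move=> [[_ Binj _] _] xB.
by rewrite -[_ - _]/(shift_op B l x) /resolvent pinvKV// inE.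
Qed.

Lemma resolvent_linear l : resolvent_set B l -> linear (resolvent B l).
Proof.
move=> lB a x y; have [xB xE] := resolventP x lB; have [yB yE] := resolventP y lB.
rewrite -[in LHS]xE -[in LHS]yE -(shift_op_linear l a xB yB).
by rewrite resolventK//; exact: dom_linear.
Qed.

Lemma resolvent_identity l m y : resolvent_set B l -> resolvent_set B m ->
  resolvent B m y =
  resolvent B l y + (l - m) *: resolvent B l (resolvent B m y).
Proof.
move=> lB mB; have [wB wE] := resolventP y mB.
set w := resolvent B m y in wB wE *.
rewrite -[LHS](resolventK lB wB).
have -> : l *: w - B w = (l - m) *: w + y by rewrite -wE scalerBl addrA subrK.
by rewrite resolvent_linear// addrC.
Qed.

End Resolvent.

(** The complexification is studied as the real Banach space X * X with the
    maximum norm, which is equivalent to the Taylor norm and hence defines the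
    same bounded operators (bounded_opP). The category, compactness and fixed
    point arguments only use the real structure, and norms then have values in
    R instead of R[i]. Accordingly cmul, rres and realify are complex scaling,
    resolvents and operators read on X * X. *)
Section RealView.
Context {R : realType} {X : completeNormedModType R}.
Local Notation XC := (complexification X).
Local Notation XR := (X * X)%type.
Implicit Types (B : linop XC) (c l m : R[i]) (z : XC).

Lemma cplx_scale_real (a : R) z : a%:C%C *: z = a *: (z : XR) :> XR.
Proof. by case: z => x y; congr pair => /=; rewrite scale0r ?subr0 ?addr0. Qed.

Lemma realify_dom B (a : R) (z w : XR) :
  dom B z -> dom B w -> dom B (a *: z + w).
Proof. by rewrite -cplx_scale_real; exact: dom_linear. Qed.

Lemma realify_op B (a : R) (z w : XR) :
  dom B z -> dom B w -> B (a *: z + w) = a *: (B z : XR) + B w :> XR.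
Proof. by rewrite -!cplx_scale_real; exact: op_linear. Qed.

Definition realify B : linop XR :=
  @Linop R XR (dom B) B (dom0 B) (@realify_dom B) (@realify_op B).

Definition abs1 c : R := `|complex.Re c| + `|complex.Im c|.

Lemma abs1_ge0 c : 0 <= abs1 c. Proof. exact: addr_ge0. Qed.

Definition cmul c (z : XR) : XR := c *: (z : XC).

Lemma cmul_le c (z : XR) : `|cmul c z| <= abs1 c * `|z|.
Proof.
have z1 : `|z.1| <= `|z| by rewrite prod_normE le_max lexx.
have z2 : `|z.2| <= `|z| by rewrite prod_normE le_max lexx orbT.
rewrite prod_normE ge_max /abs1 mulrDl; apply/andP; split => /=.
  by rewrite (le_trans (ler_normB _ _))// !normrZ lerD// ler_wpM2l.
by rewrite (le_trans (ler_normD _ _))// !normrZ lerD// ler_wpM2l.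
Qed.

Lemma cmul_linear c : linear (cmul c).
Proof.
by move=> a z w; rewrite /cmul -!cplx_scale_real scalerDr !scalerA mulrC.
Qed.

Lemma cmulZ c (a : R) (z : XR) : cmul c (a *: z) = a *: cmul c z.
Proof. by rewrite /cmul -!cplx_scale_real !scalerA mulrC. Qed.

Lemma taylor_norm_max z : taylor_norm z <= 2 * `|(z : XR)|.
Proof.
rewrite (le_trans (taylor_norm_le z))// mulr_natl mulr2n.
by rewrite lerD// prod_normE le_max lexx ?orbT.
Qed.

Lemma max_norm_taylor z : `|(z : XR)| <= taylor_norm z.
Proof. by rewrite prod_normE ge_max; apply/andP; exact: taylor_norm_ge. Qed.

Lemma bounded_opP (f : XC -> XC) : bounded_op f <->
  exists2 M : R, 0 <= M & forall z, `|(f z : XR)| <= M * `|(z : XR)|.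
Proof.
split=> [[[M M'] fM]|[M M0 fM]].
  exists (`|M| * 2) => [|z]; first by rewrite mulr_ge0.
  have := fM z; rewrite !cplx_normE lecE/= ?mulr0 subr0 => /andP[_ fz].
  rewrite (le_trans (max_norm_taylor _))// (le_trans fz)//.
  rewrite -mulrA (@le_trans _ _ (`|M| * taylor_norm z))//.
    by rewrite ler_wpM2r ?ler_norm// (le_trans _ (max_norm_taylor z)).
  by rewrite ler_wpM2l// taylor_norm_max.
exists (2 * M)%:C%C => z; rewrite !cplx_normE -rmorphM/= lecR.
rewrite (le_trans (taylor_norm_max _))// -mulrA ler_wpM2l//.
by rewrite (le_trans (fM z))// ler_wpM2l// max_norm_taylor.
Qed.

Definition rres B l : XR -> XR := resolvent B l.

Lemma rres_linear B l : resolvent_set B l -> linear (rres B l).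
Proof. by move=> lB a z w; rewrite /rres -!cplx_scale_real resolvent_linear. Qed.

Lemma rres_cmul B l c (z : XR) : resolvent_set B l ->
  rres B l (cmul c z) = cmul c (rres B l z).
Proof.
move=> lB; pose RL : {linear XC -> XC} :=
  HB.pack (resolvent B l) (GRing.isLinear.Build _ _ _ _ _ (resolvent_linear lB)).
by rewrite -[LHS]/(RL (c *: (z : XC))) linearZ.
Qed.

Lemma rres_bounded B l : resolvent_set B l ->
  exists2 M : R, 0 <= M & forall z : XR, `|rres B l z| <= M * `|z|.
Proof. by move=> [_ /bounded_opP]. Qed.

Lemma rresP B l (y : XR) : resolvent_set B l ->
  dom B (rres B l y) /\ cmul l (rres B l y) - B (rres B l y) = y :> XR.
Proof. exact: (@resolventP _ XC). Qed.

Lemma rresK B l (x : XR) : resolvent_set B l -> dom B x ->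
  rres B l (cmul l x - B x) = x.
Proof. exact: (@resolventK _ XC). Qed.

Lemma rres_identity B l m (y : XR) : resolvent_set B l -> resolvent_set B m ->
  rres B m y = rres B l y + cmul (l - m) (rres B l (rres B m y)).
Proof. exact: (@resolvent_identity _ XC). Qed.

(** A complex span is the real span of the vectors v i and 'i v i. *)
Lemma real_span n (v : 'I_n -> XC) : exists k (g : 'I_k -> XR),
  forall c : 'I_n -> R[i], exists a, (\sum_i c i *: v i : XC) = lincomb g a.
Proof.
pose g (i : 'I_(n + n)) : XR :=
  match fintype.split i with inl j => v j | inr j => 'i%C *: v j end.
exists (n + n)%N, g => c.
exists (\row_i match fintype.split i with
  inl j => complex.Re (c j) | inr j => complex.Im (c j) end).
rewrite /lincomb big_split_ord/= -big_split/=.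
apply: eq_bigr => i _; rewrite !mxE /g.
rewrite -[lshift n i]/(unsplit (inl i)) -[rshift n i]/(unsplit (inr i)) !unsplitK.
case: (c i) (v i) => a b [x y]; congr pair => /=.
  by rewrite scale0r scale1r sub0r scalerN.
by rewrite scale0r scale1r add0r.
Qed.

(** (m - B) x = y means x = R(l) (y - (m - l) x), which is a fixed point problem
    for a contraction of ratio 1 / 2. *)
Lemma resolvent_set_near B l m (M : R) : resolvent_set B l -> 0 <= M ->
  (forall z : XR, `|rres B l z| <= M * `|z|) ->
  abs1 (m - l) * M <= 2^-1 ->
  resolvent_set B m /\ forall z : XR, `|rres B m z| <= 2 * M * `|z|.
Proof.
move=> lB M0 lM ml.
have Rl := rres_linear lB.
pose RL : {linear XR -> XR} :=
  HB.pack (rres B l) (GRing.isLinear.Build _ _ _ _ _ Rl).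
have shiftE (x : XR) :
    cmul m x - B x = (cmul l x - B x) + cmul (m - l) x :> XR.
  by rewrite /cmul scalerBl [RHS]addrC addrA subrK.
have half (z : XR) : `|RL (cmul (m - l) z)| <= 2^-1 * `|z|.
  rewrite (le_trans (lM _))// (le_trans (ler_wpM2l M0 (cmul_le _ _)))//.
  by rewrite mulrA (mulrC M) ler_wpM2r.
have solve (y : XR) : exists2 x, dom B x & cmul m x - B x = y :> XR.
  pose f (x : XR) : XR := RL (y - cmul (m - l) x).
  have ff : set_fun [set: XR] [set: XR] f by [].
  pose f' : {fun [set: XR] >-> [set: XR]} := HB.pack f (isFun.Build _ _ _ _ _ ff).
  have [|//||x _ xE] := @banach_fixed_point _ _ _ f'.
  - have h0 : 0 <= 2^-1 :> R by rewrite invr_ge0.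
    exists (NngNum h0); split; first by rewrite /= invf_lt1// ltr1n.
    move=> [x1 x2] _ /=; rewrite /f -linearB/=.
    have -> : y - cmul (m - l) x1 - (y - cmul (m - l) x2) =
        cmul (m - l) (x2 - x1).
      by rewrite /cmul scalerBr opprB addrC addrA subrK.
    by rewrite (le_trans (half _))// distrC.
  - by exists 0.
  have := rresP (y - cmul (m - l) x) lB.
  rewrite -[rres _ _ _]/(f' x) -xE => -[xB yE].
  by exists x => //; rewrite shiftE yE subrK.
have bnd (x : XR) : dom B x -> `|x| <= 2 * M * `|cmul m x - B x|.
  move=> xB; have xE : x = RL (cmul m x - B x) - RL (cmul (m - l) x).
    by rewrite -linearB shiftE addrK /= rresK.
  have : `|x| <= M * `|cmul m x - B x| + 2^-1 * `|x|.
    by rewrite [X in `|X| <= _]xE (le_trans (ler_normB _ _))// lerD// lM.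
  by lra.
have inj : {in dom B &, injective (shift_op B m)}.
  move=> x y /set_mem xB /set_mem yB xy; apply/eqP; rewrite -subr_eq0.
  have xyB : dom B (x - y).
    by rewrite addrC -scaleN1r; exact: dom_linear.
  rewrite -(@normr_le0 _ XR) (le_trans (bnd _ xyB))//.
  suff -> : cmul m (x - y) - B (x - y) = 0 by rewrite normr0 mulr0.
  have := shift_op_linear m (-1) yB xB; rewrite !scaleN1r (addrC (- y)) => ->.
  by rewrite addrC; apply/eqP; rewrite subr_eq0; exact/eqP.
have mB : set_bij (dom B) [set: XC] (shift_op B m).
  split=> // y _; have [x xB xy] := solve y; by exists x.
have Rb (z : XR) : `|rres B m z| <= 2 * M * `|z|.
  have [x xB xy] := solve z.
  have -> : rres B m z = x.
    by rewrite -xy -[_ - _]/(shift_op B m x) /rres /resolvent pinvKV// inE.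
  by rewrite -xy; exact: bnd.
split; last exact: Rb.
split; first exact: mB.
by apply/bounded_opP; exists (2 * M); [rewrite mulr_ge0|exact: Rb].
Qed.

End RealView.

(** * Blow-up of the resolvent at a Fredholm point of the spectrum *)

Lemma norm_almost_attained (R : realType) (Y : normedModType R) (Q : Y -> Y) (M : R) :
  linear Q -> (forall y, `|Q y| <= M * `|y|) -> (exists y, Q y != 0) ->
  exists b : R, [/\ 0 < b, forall y, `|Q y| <= b * `|y| &
    exists2 x, `|x| <= 1 & b / 2 <= `|Q x|].
Proof.
move=> Ql QM [y0 Qy0].
pose Q' : {linear Y -> Y} := HB.pack Q (GRing.isLinear.Build _ _ _ _ _ Ql).
pose S := [set `|Q x| | x in [set x | `|x| <= 1]].
have QZ a y : Q (a *: y) = a *: Q y by rewrite -[LHS]/(Q' (a *: y)) linearZ.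
have y00 : 0 < `|y0|.
  by rewrite normr_gt0; apply: contraNN Qy0 => /eqP ->; rewrite -[Q 0]/(Q' 0) linear0.
have S0 : has_sup S.
  split; first by exists `|Q 0|, 0 => //=; rewrite normr0.
  exists `|M| => _ [x /= x1 <-]; rewrite (le_trans (QM x))//.
  rewrite (@le_trans _ _ (`|M| * `|x|))// ?ler_wpM2r ?ler_norm//.
  by rewrite ler_piMr.
have QS y : `|Q y| <= sup S * `|y|.
  have [->|y1] := eqVneq y 0; first by rewrite -[Q 0]/(Q' 0) linear0 !normr0 mulr0.
  have ny : 0 < `|y| by rewrite normr_gt0.
  rewrite -ler_pdivrMr// mulrC -{1}(gtr0_norm ny) -normfV -normrZ -QZ.
  apply: sup_upper_bound => //; exists (`|y|^-1 *: y) => //=.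
  by rewrite normrZ normfV normr_id mulVf// gt_eqF.
have s0 : 0 < sup S.
  by rewrite -(pmulr_lgt0 _ y00) (lt_le_trans _ (QS y0))// normr_gt0.
exists (sup S); split=> //.
have s2 : 0 < sup S / 2 by rewrite divr_gt0.
have [_ [x x1 <-] +] := sup_adherent s2 S0.
by rewrite {1}(splitr (sup S)) addrK => Qx; exists x => //; exact: ltW.
Qed.

Section Blowup.
Context {R : realType} {X : completeNormedModType R}.
Local Notation XC := (complexification X).
Local Notation XR := (X * X)%type.
Variables (B : linop XC) (C : set X) (l : R -> R[i]) (l0 : R[i]).
Variable F : set_system R.
Hypothesis Ctotal : total_cone C.

(** Since E is closed under differences and limits, it contains both axes as
    soon as it contains the copies of the cone on them: C - C is dense. *)
Lemma cone_span_dense (E : set XR) : is_subspace E -> closed E ->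
  (forall x, C x -> E (x, 0)) -> (forall x, C x -> E (0, x)) -> forall z, E z.
Proof.
move=> El Ecl E1 E2 [x y].
have cl (e : X -> XR) : (forall x y, e (x - y) = e x - e y) -> 
    (forall x y, `|e x - e y| <= `|x - y|) -> (forall x, C x -> E (e x)) ->
    forall x, E (e x).
  move=> eB en eC u; apply: Ecl => U /nbhs_ballP[r /= r0 rU].
  have [w [uw [a aC [b bC wE]]]] : ball u r `&` [set x - y | x in C & y in C] !=set0.
    apply: Ctotal; last exact: ball_open.
    by exists u; exact: ballxx.
  rewrite -{w}wE in uw; exists (e (a - b)); split.
    by rewrite eB; apply: subspaceB El _ _; exact: eC.
  apply: rU; rewrite -ball_normE /= (le_lt_trans (en _ _))//.
  by move: uw; rewrite -ball_normE.
have -> : (x, y) = (1 : R) *: ((x, 0) : XR) + (0, y).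
  by rewrite scale1r; congr pair; rewrite /= ?addr0 ?add0r.
apply: El.2.
  apply: (cl (fun x => (x, 0) : XR)) => // a b.
    by congr pair; rewrite subr0.
  by rewrite prod_normE/= subr0 normr0 ge_max lexx/=.
apply: (cl (fun x => (0, x) : XR)) => // a b.
  by congr pair; rewrite subr0.
by rewrite prod_normE/= subr0 normr0 ge_max lexx andbT.
Qed.

(** Here b r is the norm of R(l r) up to a factor 2. It tends to infinity,
    since otherwise l0 would be regular. By fredholm_blowup and the density of
    the span of the cone, R(l r) x / b r does not tend to 0 for some x in the
    cone; its image under l0 - B tends to 0, so fredholm_ultra_cvg provides a
    limit in the kernel. *)
Theorem resolvent_blowup : UltraFilter F ->
  (\forall r \near F, resolvent_set B (l r)) ->
  abs1 (l r - l0) @[r --> F] --> 0 ->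
  ~ resolvent_set B l0 -> fredholm (shift_op B l0) ->
  exists (x : X) (v : XR) (b : R -> R),
    [/\ C x, (\forall r \near F, resolvent_set B (l r) /\ 0 < b r),
      (b r)^-1 @[r --> F] --> 0,
      [/\ dom B v, v != 0 & B v = cmul l0 v :> XR] &
      (b r)^-1 *: rres B (l r) (x, 0) @[r --> F] --> v].
Proof.
move=> FU lB ll0 nB [[nk [vk kerB]] [nc [vc codimB]]].
have FP : ProperFilter F by exact: ultra_proper.
(* Near a spectral point the resolvent is large. *)
have far r M : resolvent_set B (l r) -> 0 <= M ->
    (forall y, `|rres B (l r) y| <= M * `|y|) -> 2^-1 < M * abs1 (l r - l0).
  move=> rB M0 RM; rewrite ltNge; apply/negP => le2; apply: nB.
  apply: (resolvent_set_near rB M0 RM _).1.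
  by rewrite /abs1 -opprB !raddfN/= !normrN mulrC.
clear nB.
have /choice[b bP] : forall r, exists b, resolvent_set B (l r) ->
    [/\ 0 < b, forall y, `|rres B (l r) y| <= b * `|y| &
     exists2 x, `|x| <= 1 & b / 2 <= `|rres B (l r) x|].
  move=> r; have [rB|nrB] := pselect (resolvent_set B (l r)); last first.
    by exists 0 => rB; case: (nrB rB).
  have [M M0 RM] := rres_bounded rB.
  have [|b bP] := norm_almost_attained (rres_linear rB) RM; last first.
    by exists b => _; exact: bP.
  apply: contrapT => R0; have := far r 0 rB (lexx 0).
  rewrite mul0r => lt20; suff : (2^-1 : R) < 0 by rewrite invr_lt0 ltrn0.
  apply: lt20 => z; rewrite mul0r normr_le0; apply: contrapT => /negP Rz.
  by apply: R0; exists z.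
have b0 : (b r)^-1 @[r --> F] --> 0.
  have ll2 : 2 * abs1 (l r - l0) @[r --> F] --> 0.
    by rewrite -(mulr0 2); exact: cvgMl_tmp.
  apply: (@squeeze_cvgr _ _ _ _ (fun=> 0) (fun r => 2 * abs1 (l r - l0))) => //;
    last exact: cvg_cst.
  apply: filterS lB => r rB; have [br Rb _] := bP _ rB.
  rewrite invr_ge0 (ltW br)/=.
  have := far r (b r) rB (ltW br) Rb.
  by rewrite -[leLHS]div1r ler_pdivrMr//; lra.
have [r1 r1B] : exists r, resolvent_set B (l r) by exact: filter_ex lB.
have [t t0 Tt] := rres_bounded r1B.
pose Bf := realify (shift_op B l0).
pose kap : XR -> XR := cmul (l r1 - l0).
have shiftE c (x : XR) : dom B x ->
    Bf x + cmul (c - l0) x = cmul c x - B x :> XR.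
  move=> xB; rewrite /Bf/= /cmul scalerBl.
  by rewrite addrC addrA subrK.
have TB y : dom Bf (rres B (l r1) y) /\
    Bf (rres B (l r1) y) = y - kap (rres B (l r1) y).
  have [yB yE] := rresP y r1B; split=> //.
  by rewrite -{2}yE -shiftE// addrK.
have BT x : dom Bf x -> rres B (l r1) (Bf x + kap x) = x.
  by move=> xB; rewrite shiftE// rresK.
have [k [f fk]] := real_span vc.
have fB y : exists a, [set Bf x | x in dom Bf] (y - lincomb f a).
  by have [c yc] := codimB y; have [a ca] := fk c; exists a; rewrite -ca.
have [n [g gk]] := real_span vk.
have gB x : dom Bf x -> Bf x = 0 -> exists a, x = lincomb g a.
  move=> xB Bx0.
  have : [set x | dom (shift_op B l0) x /\ shift_op B l0 x = 0] x by [].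
  by rewrite kerB => -[c _ <-]; exact: gk.
(* The resolvents are normalized by their norms, up to a factor 2. *)
pose Q r (y : XR) := (b r)^-1 *: rres B (l r) y.
pose E := [set y | Q r y @[r --> F] --> (0 : XR)].
have [El Ecl] : is_subspace E /\ closed E.
  apply: null_set_closed; apply: filterS lB => r rB.
  have [br Rb _] := bP _ rB; split.
    move=> a y z; rewrite /Q (rres_linear rB) scalerDr !scalerA mulrC//.
  move=> y; rewrite /Q normrZ gtr0_norm ?invr_gt0// mulrC ler_pdivrMr// mulrC.
  exact: Rb.
have [x xC nx] : exists2 x, C x & ~ E (x, 0).
  apply: contrapT => nE.
  have E1 x : C x -> E (x, 0).
    by move=> xC; apply: contrapT => nx; apply: nE; exists x.
  (* E is even a complex subspace. *)
  have E2 x : C x -> E (0, x).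
    move=> /E1 Ex; pose ci : XR -> XR := cmul 'i%C.
    have cic : continuous ci := bounded_linear_continuous_at (cmul_linear _) (cmul_le _).
    have ci0 : ci 0 = 0 by rewrite /ci /cmul scaler0.
    have ciE : ci (x, 0) = (0, x).
      by congr pair => /=; rewrite ?scale0r ?scale1r ?scaler0 ?subr0 ?add0r.
    have : ci (Q r (x, 0)) @[r --> F] --> ci 0.
      by apply: continuous_cvg => //; exact: cic.
    rewrite ci0; apply: cvg_trans; apply: near_eq_cvg; apply: filterS lB => r rB.
    by rewrite /Q -ciE rres_cmul// /ci cmulZ.
  have Eall := cone_span_dense El Ecl E1 E2.
  apply: (fredholm_blowup t0 (abs1_ge0 _) (rres_linear r1B) Tt (cmul_le _)
    TB BT fB FP (Q := fun r => rres B (l r)) (eta := fun r => cmul (l r - l0))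
    (b := b) (s := fun r => abs1 (l r - l0))) => //.
  apply: filterS lB => r rB.
  have [br Rb Rx] := bP _ rB; split=> //; first exact: rres_linear.
  split=> //; [exact: abs1_ge0|exact: cmul_le|].
  by move=> y yB; rewrite shiftE// rresK.
pose v r := Q r (x, 0).
have vB : \forall r \near F, [/\ dom Bf (v r), `|v r| <= `|((x, 0) : XR)| &
    Bf (v r) = (b r)^-1 *: (x, 0) - cmul (l r - l0) (v r)].
  apply: filterS lB => r rB; have [br Rb _] := bP _ rB.
  have [wB wE] := rresP (x, 0) rB.
  split; first exact: subspaceZ (subspace_dom Bf) wB.
    rewrite normrZ gtr0_norm ?invr_gt0// mulrC ler_pdivrMr// mulrC.
    exact: Rb.
  rewrite linopZ// -[Bf _](addrK (cmul (l r - l0) (rres B (l r) (x, 0)))).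
  rewrite shiftE// wE scalerBr; congr (_ - _).
  by rewrite -cmulZ.
have [w [wB Bw vw]] : exists w, [/\ dom Bf w, Bf w = 0 & v i @[i --> F] --> w].
  apply: (fredholm_ultra_cvg t0 (abs1_ge0 _) (rres_linear r1B) Tt (cmul_le _)
    (cmul_linear _) TB BT fB gB FU (M := `|((x, 0) : XR)|)).
  - by apply: filterS vB => r [].
  - by apply: filterS vB => r [].
  have e1 : (b r)^-1 *: ((x, 0) : XR) @[r --> F] --> (0 : XR).
    by rewrite -(scale0r ((x, 0) : XR)); exact: cvgZr_tmp.
  have e2 : cmul (l r - l0) (v r) @[r --> F] --> (0 : XR).
    apply/norm_cvg0P; apply: (@squeeze_cvgr _ _ _ _ (fun=> 0)
      (fun r => abs1 (l r - l0) * `|((x, 0) : XR)|)).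
    - apply: filterS vB => r [_ vx _]; rewrite normr_ge0/=.
      by rewrite (le_trans (cmul_le _ _))// ler_wpM2l// abs1_ge0.
    - exact: cvg_cst.
    - by rewrite -(mul0r `|((x, 0) : XR)|); exact: cvgMr_tmp.
  have e3 := cvgB e1 e2; rewrite subr0 in e3.
  apply: (cvg_trans _ (e3 _)); apply: near_eq_cvg; apply: filterS vB => r [_ _ ->] //.
exists x, w, b; split=> //.
  by apply: filterS lB => r rB; split=> //; case: (bP _ rB).
split=> //; last by apply/esym/eqP; rewrite -subr_eq0; apply/eqP.
by apply/eqP => w0; apply: nx; rewrite /E/= -w0.
Qed.

End Blowup.

(** * Propagation of positivity along resolvents *)

(** In the applications f s is a resolvent at a point moving with velocity - U,
    and fid is the resolvent identity. *)
Section Propagation.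
Context {R : realType} {Y : normedModType R}.
Variables (P : set Y) (U : Y -> Y) (u : R) (f : R -> Y -> Y) (r : R).
Hypotheses (Pcl : closed P) (P0 : P 0).
Hypothesis PD : forall x y, P x -> P y -> P (x + y).
Hypothesis PZ : forall (a : R) x, 0 <= a -> P x -> P (a *: x).
Hypotheses (Ulin : linear U) (u0 : 0 <= u).
Hypothesis Ub : forall y, `|U y| <= u * `|y|.
Hypothesis UP : forall y, P y -> P (U y).
Hypothesis flin : forall s, 0 <= s <= r -> linear (f s).
Hypothesis fb : forall s, 0 <= s <= r ->
  exists2 M, 0 <= M & forall y, `|f s y| <= M * `|y|.
Hypothesis fid : forall s t y, 0 <= s <= r -> 0 <= t <= r ->
  f t y = f s y + (t - s) *: U (f s (f t y)).

Let good s := forall y, P y -> P (f s y).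

(** The iteration z |-> y + G z started at 0 stays in P and converges to w. *)
Lemma fixed_point_positive (G : Y -> Y) (y w : Y) :
  linear G -> (forall z, `|G z| <= 2^-1 * `|z|) -> (forall z, P z -> P (G z)) ->
  P y -> w = y + G w -> P w.
Proof.
move=> Gl Gb GP Py wE.
pose wn n := iter n (fun z => y + G z) 0.
have wnP n : P (wn n) by elim: n => //= n IH; apply: PD => //; exact: GP.
pose GL : {linear Y -> Y} := HB.pack G (GRing.isLinear.Build _ _ _ _ _ Gl).
have wb n : `|w - wn n| <= geometric `|w| 2^-1 n.
  elim: n => [|n IH]; first by rewrite /= subr0 expr0 mulr1.
  have -> : w - wn n.+1 = GL (w - wn n).
    by rewrite linearB {1}wE /= opprD addrACA subrr add0r.
  by rewrite (le_trans (Gb _))//= exprS mulrCA ler_wpM2l.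
have half1 : `|2^-1 : R| < 1 by rewrite gtr0_norm// invf_lt1// ltr1n.
have wnw : wn n @[n --> \oo] --> w.
  apply/subr_cvg0/norm_cvg0P.
  apply: (@squeeze_cvgr _ _ _ _ (fun=> 0) (geometric `|w| 2^-1)).
  - by apply: nearW => n; rewrite normr_ge0 distrC wb.
  - exact: cvg_cst.
  - exact: cvg_geometric.
by apply: (closed_cvg P Pcl _ _ wnw); exact: nearW.
Qed.

(* Near s0 all f s are bounded by 2 M, where M bounds f s0; the factor 8 makes
   (t - s) U (f s) a contraction of ratio 1 / 2 for s and t in the
   neighbourhood. *)
Let propagate_local s0 : 0 <= s0 <= r -> exists2 d, 0 < d &
  forall s t, 0 <= s <= r -> 0 <= t <= r -> `|s - s0| < d -> `|t - s0| < d ->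
    s <= t -> good s -> good t.
Proof.
move=> s0r; have [M M0 fM] := fb s0r.
have uM0 : 0 <= u * M by exact: mulr_ge0.
exists (8 * (u * M + 1))^-1; first by rewrite invr_gt0 mulr_gt0// ltr_wpDl.
set d := _^-1 => s t sr tr sd td st gs y Py.
have d0 : 0 < d by rewrite invr_gt0 mulr_gt0// ltr_wpDl.
have dM : d * (u * M) <= 8^-1.
  rewrite /d invfM -mulrA ler_piMr// ler_pdivrMl ?ltr_wpDl// mulr1.
  by rewrite lerDl.
have fsM z : `|f s z| <= 2 * M * `|z|.
  have : `|f s z| <= M * `|z| + 2^-1 * `|f s z|.
    rewrite {1}(fid z s0r sr) (le_trans (ler_normD _ _))// lerD//.
    rewrite normrZ (le_trans (ler_wpM2l _ (Ub _)))//.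
    rewrite (le_trans (ler_wpM2l _ (ler_wpM2l u0 (fM _))))//.
    rewrite !mulrA ler_wpM2r// -mulrA.
    rewrite (le_trans (ler_wpM2r uM0 (ltW sd)))// (le_trans dM)//.
    by rewrite lef_pV2 ?posrE// ler_nat.
  by lra.
pose G z := (t - s) *: U (f s z).
apply: (@fixed_point_positive G (f s y)) => //.
- move=> a z w; rewrite /G (flin sr) Ulin !scalerDr !scalerA.
  by rewrite (mulrC a).
- move=> z; rewrite /G normrZ (le_trans (ler_wpM2l _ (Ub _)))//.
  rewrite (le_trans (ler_wpM2l _ (ler_wpM2l u0 (fsM _))))//.
  rewrite !mulrA ler_wpM2r//.
  have ts : `|t - s| <= 2 * d.
    rewrite (_ : t - s = (t - s0) - (s - s0)); last by rewrite opprB addrA subrK.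
    by rewrite (le_trans (ler_normB _ _))// mulr_natl mulr2n lerD// ltW.
  rewrite (_ : _ * M = 2 * (`|t - s| * (u * M))); last by ring.
  have := ler_wpM2r uM0 ts; rewrite -mulrA; set a := _ * (u * M) => le1.
  have := dM; lra.
- by move=> z Pz; apply: PZ; rewrite ?subr_ge0//; apply: UP; exact: gs.
- exact: gs.
- exact: fid.
Qed.

Theorem propagate_positive : 0 <= r -> good 0 -> good r.
Proof.
move=> r0 g0.
pose S := [set s | 0 <= s <= r /\ forall t, 0 <= t <= s -> good t].
have S0 : S 0 by split=> [|t /le_anti <-]; rewrite ?lexx.
have Ss : has_sup S by split; [exists 0|exists r => s [/andP[]]].
have Sr : 0 <= sup S <= r.
  rewrite (sup_upper_bound Ss)//=; apply: ge_sup; first by exists 0.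
  by move=> s [/andP[]].
have [d d0 dP] := propagate_local Sr.
have [s [sr sg] sd] := sup_adherent d0 Ss.
have sS : s <= sup S by apply: (sup_upper_bound Ss); split.
pose t := Num.min (sup S + d / 2) r.
have d2 : 0 < d / 2 by rewrite divr_gt0.
have tS : S t.
  have tr : 0 <= t <= r.
    rewrite ge_min lexx orbT andbT le_min r0 andbT addr_ge0 ?(ltW d2)//.
    by case/andP: Sr.
  split=> // t' /andP[t'0 t't].
  have [t's|st'] := leP t' s; first by apply: sg; rewrite t'0.
  apply: (dP s) => //.
  - by rewrite t'0 (le_trans t't)//; case/andP: tr.
  - by rewrite ltr_norml; apply/andP; split; lra.
  - have : t' <= sup S + d / 2 by rewrite (le_trans t't)// ge_min lexx.
    by rewrite ltr_norml => t'd; apply/andP; split; lra.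
  - exact: ltW.
  - by apply: sg; rewrite lexx andbT; case/andP: sr.
have : t <= sup S by exact: (sup_upper_bound Ss).
rewrite ge_min => /orP[|rS]; first by lra.
apply: (tS.2); rewrite r0/=.
by rewrite le_min lexx andbT (le_trans rS)// lerDl ltW.
Qed.

End Propagation.

(** * Resolvents off the real axis are dominated by real ones *)

Section Domination.
Context {R : realType} {X : completeNormedModType R}.
Local Notation XC := (complexification X).
Local Notation XR := (X * X)%type.
Variables (C : set X) (A : linop X).
Hypothesis hC : ordered_banach C.
Local Notation B := (complexify A).

(** At a real point the resolvent acts on real and imaginary parts
    separately. *)
Lemma rres_real_part (m : R) (z : XR) : resolvent_set B m%:C%C ->
  (rres B m%:C%C z).1 = resolvent A m z.1.
Proof.
move=> mB.
have -> : z = (1 : R) *: ((z.1, 0) : XR) + cmul 'i%C (z.2, 0).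
  rewrite scale1r; case: z => x y; congr pair => /=.
    by rewrite ?(scaler0, scale0r, scale1r, subr0, oppr0, addr0).
  by rewrite ?(scaler0, scale0r, scale1r, add0r, addr0).
rewrite rres_linear// rres_cmul// /rres !resolvent_complexify//.
by rewrite /= ?(scaler0, scale0r, scale1r, subr0, oppr0, addr0).
Qed.

Lemma cone0 : C 0.
Proof.
have : (C `&` [set x | C (- x)]) 0 by rewrite (cone_pointed hC).
by case.
Qed.

Lemma normC1_Re (c : R[i]) : `|c| = 1 -> complex.Re c <= 1.
Proof.
move=> c1; rewrite -lecR (le_trans _ (lexx 1))// -c1.
by rewrite (le_trans _ (normc_ge_Re c))// lecR ler_norm.
Qed.

(** Propagation for the pairs (R(mu - s e), R(mu - s)) and the closed cone P of
    the pairs (z, w) with Re (w - d z) in C for every d of modulus 1. At s = 0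
    both components are the same positive operator, which acts on real parts,
    hence preserves P. The velocity (e, 1) preserves P because the set of the
    admissible d is invariant under multiplication by e. *)
Theorem resolvent_dominated (mu r : R) (e : R[i]) (x : X) (c : R[i]) :
  (forall s, 0 <= s <= r -> resolvent_set B (mu%:C%C - s%:C%C * e)) ->
  (forall s, 0 <= s <= r -> resolvent_set B (mu - s)%:C%C) ->
  positive_op C (resolvent A mu) -> `|e| = 1 -> `|c| = 1 -> 0 <= r -> C x ->
  C ((rres B (mu - r)%:C%C (x, 0) -
      cmul c (rres B (mu%:C%C - r%:C%C * e) (x, 0))).1).
Proof.
move=> eB tB mup e1 c1 r0 Cx.
pose lam s : R[i] := mu%:C%C - s%:C%C * e.
pose tau s : R[i] := (mu - s)%:C%C.
pose h (d : R[i]) (p : XR * XR) : X := (p.2 - cmul d p.1).1.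
pose P := [set p | forall d : R[i], `|d| = 1 -> C (h d p)].
have hl d : linear (h d).
  by move=> a p q; rewrite /h (cmul_linear d) opprD addrACA -scalerBr.
have hD d p q : h d (p + q) = h d p + h d q.
  by have := hl d 1 p q; rewrite !scale1r.
have h0 d : h d 0 = 0 by rewrite /h /cmul /= !scaler0 !subr0.
have hZ d a p : h d (a *: p) = a *: h d p.
  by have := hl d a p 0; rewrite h0 !addr0.
have cmul_real (a : R) b (z : XR) : cmul (a%:C%C * b) z = a *: cmul b z.
  by rewrite /cmul -scalerA cplx_scale_real.
pose U (p : XR * XR) : XR * XR := (cmul e p.1, p.2).
pose f s (p : XR * XR) : XR * XR := (rres B (lam s) p.1, rres B (tau s) p.2).
suff : P (f r ((x, 0), (x, 0))) by move=> /(_ c c1).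
have fst_le (p : XR * XR) : `|p.1| <= `|p| by rewrite prod_normE le_max lexx.
have snd_le (p : XR * XR) : `|p.2| <= `|p| by rewrite prod_normE le_max lexx orbT.
have pair_le (p : XR * XR) (m1 m2 : R) (y : XR * XR) : 0 <= m1 -> 0 <= m2 ->
    `|p.1| <= m1 * `|y.1| -> `|p.2| <= m2 * `|y.2| -> `|p| <= (m1 + m2) * `|y|.
  move=> m10 m20 p1 p2; rewrite prod_normE ge_max; apply/andP; split.
    rewrite (le_trans p1)// mulrDl -[leLHS]addr0 lerD// ?mulr_ge0//.
    by rewrite ler_wpM2l.
  rewrite (le_trans p2)// mulrDl -[leLHS]add0r lerD// ?mulr_ge0//.
  by rewrite ler_wpM2l.
apply: (@propagate_positive _ _ P U (abs1 e + 1) f r) => //.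
- rewrite (_ : P = \bigcap_(d in [set d | `|d| = 1]) (h d @^-1` C)); last first.
    by apply/seteqP; split=> p pP d; exact: pP.
  apply: closed_bigI => d _; apply: closed_comp; last exact: cone_closed hC.
  move=> p _; apply: (bounded_linear_continuous_at (hl d) (M := 1 + abs1 d)).
  move=> q; have h1 (z : XR) : `|z.1| <= `|z| by rewrite prod_normE le_max lexx.
  rewrite /h (le_trans (h1 _))// (le_trans (ler_normB _ _))// mulrDl lerD//.
    by rewrite mul1r.
  by rewrite (le_trans (cmul_le _ _))// ler_wpM2l// abs1_ge0.
- by move=> d _; rewrite h0; exact: cone0.
- by move=> p q pP qP d d1; rewrite hD; apply: coneD hC _ _ _ _; [exact: pP|exact: qP].
- by move=> a p a0 pP d d1; rewrite hZ; apply: coneZ hC _ _ _ _ => //; exact: pP.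
- by move=> a p q; rewrite /U cmul_linear.
- by rewrite addr_ge0// abs1_ge0.
- by move=> p; apply: pair_le; rewrite ?abs1_ge0 ?mul1r//; exact: cmul_le.
- move=> p pP d d1.
  have -> : h d (U p) = h (d * e) p by rewrite /h /cmul -scalerA.
  by apply: pP; rewrite normrM d1 e1 mulr1.
- by move=> s sr a p q; rewrite /f (rres_linear (eB s sr)) (rres_linear (tB s sr)).
- move=> s sr; have [M1 M10 f1] := rres_bounded (eB s sr).
  have [M2 M20 f2] := rres_bounded (tB s sr).
  exists (M1 + M2) => [|p]; first exact: addr_ge0.
  by apply: pair_le => //; [exact: f1|exact: f2].
- move=> s t p sr tr; rewrite /f; congr pair => /=.
    rewrite {1}(rres_identity p.1 (eB s sr) (eB t tr)) -cmul_real; congr (_ + cmul _ _).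
    by rewrite /lam rmorphB/=; ring.
  rewrite {1}(rres_identity p.2 (tB s sr) (tB t tr)).
  rewrite -[(t - s) *: _]scale1r; congr (_ + _).
  have -> : tau s - tau t = (t - s)%:C%C * 1 by rewrite /tau !rmorphB/=; ring.
  by rewrite cmul_real /cmul !scale1r.
- have r00 : 0 <= (0 : R) <= r by rewrite lexx r0.
  move=> p pP d d1; have mB : resolvent_set B mu%:C%C by have := tB 0 r00; rewrite subr0.
  pose RL : {linear XR -> XR} := HB.pack (rres B mu%:C%C)
    (GRing.isLinear.Build _ _ _ _ _ (rres_linear mB)).
  have -> : f 0 p = (rres B mu%:C%C p.1, rres B mu%:C%C p.2).
    by rewrite /f /lam /tau mul0r !subr0.
  have -> : h d (rres B mu%:C%C p.1, rres B mu%:C%C p.2) = resolvent A mu (h d p).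
    rewrite -rres_real_part// -[rres B _ (p.2 - _)]/(RL _) linearB/=.
    by rewrite rres_cmul.
  by apply: mup; exact: pP.
- move=> d d1; rewrite (_ : h d _ = (1 - complex.Re d) *: x).
    by apply: coneZ hC _ _ _ _ => //; rewrite subr_ge0 normC1_Re.
  by rewrite /h /= scaler0 subr0 scalerBl scale1r.
Qed.

End Domination.


(** * The spectral bound *)

Section SpectralBound.
Context {R : realType} {X : completeNormedModType R}.
Local Notation XC := (complexification X).
Local Notation XR := (X * X)%type.

Lemma resolvent_set_open (B : linop XC) (l : R[i]) : resolvent_set B l ->
  exists (d M : R), [/\ 0 < d, 0 <= M & forall m, abs1 (m - l) < d ->
    resolvent_set B m /\ forall z : XR, `|rres B m z| <= M * `|z|].
Proof.
move=> lB; have [M M0 RM] := rres_bounded lB.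
exists (2 * (M + 1))^-1, (2 * M); split.
- by rewrite invr_gt0 mulr_gt0// ltr_wpDl.
- by rewrite mulr_ge0.
move=> m ml; apply: (resolvent_set_near lB M0 RM _).
have M1 : 0 < 2 * (M + 1) by lra.
have := ml; rewrite -[ltRHS]div1r ltr_pdivlMr// => ml2.
have := abs1_ge0 (m - l); move: (abs1 _) ml2 => a ml2 a0; lra.
Qed.

Lemma abs1_real (a : R) (c : R[i]) : abs1 (a%:C%C * c) = `|a| * abs1 c.
Proof. by case: c => x y; rewrite /abs1/= !mul0r subr0 addr0 !normrM mulrDr. Qed.

Variables (C : set X) (A : linop X).
Hypothesis hC : ordered_banach C.
Hypothesis Ctotal : total_cone C.
Hypothesis hA : resolvent_positive C A.
Local Notation B := (complexify A).

(** The case e = 1 and c = -1 of domination, with both paths equal. *)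
Lemma positive_resolvent (t : R) :
  (forall s, t <= s -> resolvent_set B s%:C%C) -> positive_op C (resolvent A t).
Proof.
move=> tB x Cx; have [om omA] := hA.
pose mu := Num.max om t + 1.
have omu : om < mu by rewrite /mu ltr_pwDr// le_max lexx.
have tmu : t < mu by rewrite /mu ltr_pwDr// le_max lexx orbT.
have muE (s : R) : mu%:C%C - s%:C%C * 1 = (mu - s)%:C%C by rewrite mulr1 rmorphB.
have tE : mu - (mu - t) = t by rewrite opprB addrCA subrr addr0.
have tB' s : 0 <= s <= mu - t -> resolvent_set B (mu - s)%:C%C.
  by move=> /andP[_ s1]; apply: tB; rewrite lerBrDl -lerBrDr.
have := @resolvent_dominated _ _ C A hC mu (mu - t) 1 x (-1) _ tB' (omA mu omu).2.
rewrite muE tE => /(_ _ _ _ _ Cx).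
rewrite /cmul scaleN1r opprK /= rres_real_part//; last exact: tB.
move=> H; rewrite -[resolvent A t x]scale1r.
have -> : (1 : R) = 2^-1 * (1 + 1) by rewrite mulVf.
rewrite -scalerA scalerDl scale1r; apply: coneZ hC _ _ _ _; first by rewrite invr_ge0.
apply: H.
- by move=> s; rewrite muE; exact: tB'.
- exact: normr1.
- exact: normrN1.
- by rewrite subr_ge0 ltW.
Qed.

(** For real t > s the blow-up of R(t) x takes place inside the closed cone. *)
Lemma positive_eigenvector (s : R) :
  (forall t, s < t -> resolvent_set B t%:C%C) -> ~ resolvent_set B s%:C%C ->
  fredholm (shift_op B s%:C%C) ->
  exists x, [/\ dom A x, x != 0, C x & A x = s *: x].
Proof.
move=> tB sB sF.
have tp t : s < t -> positive_op C (resolvent A t).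
  by move=> st; apply: positive_resolvent => t' tt'; apply: tB; exact: lt_le_trans tt'.
have [F [FU sF']] := ultraFilterLemma (at_right_proper_filter s).
have FP : ProperFilter F by exact: ultra_proper.
have Fs : \forall t \near F, s < t by apply: sF'; exact: nbhs_right_gt.
have Fid : t @[t --> F] --> s.
  apply: (@cvg_trans _ (s^'+)); last exact: cvg_within.
  by move=> V /sF'.
have FB : \forall t \near F, resolvent_set B t%:C%C.
  by apply: filterS Fs => t; exact: tB.
have Fc : abs1 (t%:C%C - s%:C%C) @[t --> F] --> 0.
  apply: (@cvg_trans _ ((fun t => `|t - s|) @ F)).
    apply: near_eq_cvg; apply: filterE => t.
    by rewrite -rmorphB /abs1/= normr0 addr0.
  by apply/norm_cvg0P/subr_cvg0.
have [x [v [b [Cx Fb b0 [vB vn0 Bv] bv]]]] := resolvent_blowup Ctotal FU FB Fc sB sF.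
have RE : \forall t \near F, (b t)^-1 *: rres B t%:C%C (x, 0) =
    ((b t)^-1 *: resolvent A t x, 0) :> XR.
  apply: filterS FB => t tB'; rewrite /rres (resolvent_complexify _ tB').
  by apply: injective_projections; rewrite /= ?scaler0.
have v1 : (b t)^-1 *: resolvent A t x @[t --> F] --> v.1.
  apply: (@cvg_trans _ ((fun t => ((b t)^-1 *: rres B t%:C%C (x, 0)).1) @ F)).
    by apply: near_eq_cvg; apply: filterS RE => t ->.
  by apply: continuous_cvg => //; exact: cvg_fst.
have v2 : v.2 = 0.
  apply: (@cvg_unique _ (@norm_hausdorff _ X) ((fun=> 0 : X) @ F)) => //;
    last exact: cvg_cst.
  apply: (@cvg_trans _ ((fun t => ((b t)^-1 *: rres B t%:C%C (x, 0)).2) @ F)).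
    by apply: near_eq_cvg; apply: filterS RE => t ->.
  by apply: continuous_cvg => //; exact: cvg_snd.
exists v.1; split; first by case: vB.
- by apply: contraNN vn0 => /eqP v10; case: (v) v10 v2 => y z /= -> ->.
- apply: (closed_cvg C (cone_closed hC) _ _ v1).
  apply: filterS2 Fs Fb => t st [_ bt]; apply: coneZ hC _ _ _ _.
    by rewrite invr_ge0 ltW.
  exact: tp.
- have := congr1 fst Bv; rewrite /cmul cplx_scale_real/=; exact.
Qed.

(** The spectrum to the right of a, if it consists of Fredholm points only,
    cannot avoid the real axis: on the segment from a large real mu to a
    spectral point l', the resolvent blows up at the first spectral point, but
    it is dominated by real resolvents at points that stay above a. *)
Theorem half_plane_resolvent (a : R) :
  (forall s, a <= s -> resolvent_set B s%:C%C) ->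
  (forall l, a < complex.Re l -> fredholm (shift_op B l)) ->
  forall l, a < complex.Re l -> resolvent_set B l.
Proof.
move=> aB aF l' al'; apply: contrapT => l'B; have [om omA] := hA.
pose al := complex.Re l'; pose be := complex.Im l'.
have aal : 0 < al - a by rewrite subr_gt0.
(* The last term makes |mu - l'| < mu - a: as mu grows, |mu - l'| is mu - al up
   to o(1). *)
pose mu := Num.max om al + 1 + be ^+ 2 / (al - a).
have be0 : 0 <= be ^+ 2 / (al - a) by rewrite divr_ge0 ?sqr_ge0// ltW.
have ommu : om < mu.
  by rewrite /mu -addrA ltr_pwDr ?le_max ?lexx// ltr_wpDr.
have almu : al + be ^+ 2 / (al - a) < mu.
  by rewrite /mu ltrD2r ltr_pwDr// le_max lexx orbT.
have mupos := (omA mu ommu).2.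
pose r := Num.sqrt ((mu - al) ^+ 2 + be ^+ 2).
have rE : `|mu%:C%C - l'| = r%:C%C.
  rewrite /r /al /be; case: (l') => x y.
  by rewrite normc_def/= add0r sqrrN.
have r0 : 0 < r.
  by rewrite sqrtr_gt0 ltr_wpDr ?sqr_ge0// exprn_gt0// subr_gt0; lra.
have rmu : r < mu - a.
  have mua : 0 < mu - a by lra.
  rewrite -[ltRHS](gtr0_norm mua) -sqrtr_sqr ltr_sqrt ?exprn_gt0//.
  have -> : be ^+ 2 = be ^+ 2 / (al - a) * (al - a) by rewrite divfK// gt_eqF.
  move: (be ^+ 2 / _) be0 almu => q q0 qmu.
  have : 0 < (al - a) * (mu - al - q) by rewrite mulr_gt0//; lra.
  have : 0 <= (al - a) * (mu - al) by rewrite mulr_ge0//; lra.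
  have : 0 < (al - a) ^+ 2 by rewrite exprn_gt0.
  by lra.
pose e := (mu%:C%C - l') / r%:C%C.
have rn0 : r%:C%C != 0 :> R[i] by rewrite gt_eqF// ltcR.
have e1 : `|e| = 1.
  by rewrite normrM normfV rE normc_def/= expr0n/= addr0 sqrtr_sqr gtr0_norm// divff.
pose lam s : R[i] := mu%:C%C - s%:C%C * e.
have lam_r : lam r = l' by rewrite /lam /e mulrCA divff// mulr1 opprB addrCA subrr addr0.
have lamB s t : lam s - lam t = (t - s)%:C%C * e.
  by rewrite /lam rmorphB/=; ring.
have lam_Re s : 0 <= s -> mu - s <= complex.Re (lam s).
  move=> sge; have := normC1_Re e1; rewrite /lam; case: (e) => x y /= x1.
  by rewrite mul0r subr0 lerD2l lerN2 ler_piMr.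
(* The first spectral point on the segment is lam (inf S). *)
pose S := [set s | 0 <= s <= r /\ ~ resolvent_set B (lam s)].
have Sr : S r by split; [rewrite lexx ltW|rewrite lam_r].
clear l'B.
have Si : has_inf S by split; [exists r|exists 0 => s [/andP[]]].
pose s0 := inf S.
have s00 : 0 <= s0 by apply: lb_le_inf; [exists r|move=> s [/andP[]]].
have s0r : s0 <= r by apply: ge_inf => //; case: Si.
have below s : 0 <= s -> s < s0 -> resolvent_set B (lam s).
  move=> sge ss0; apply: contrapT => sB.
  have : s0 <= s.
    apply: ge_inf; first by case: Si.
    by split=> //; rewrite sge (le_trans (ltW ss0)).
  by rewrite leNgt ss0.
have s0B : ~ resolvent_set B (lam s0).
  move=> s0B; have [d [M [d0 M0 dB]]] := resolvent_set_open s0B.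
  have e0 : 0 < abs1 e + 1 by rewrite ltr_wpDl// abs1_ge0.
  have [s [sr sB] sd] := inf_adherent (divr_gt0 d0 e0) Si.
  have s0s : s0 <= s by apply: ge_inf; [case: Si|exact: conj sr sB].
  move: sB; apply; apply: (dB _ _).1.
  rewrite lamB abs1_real ler0_norm ?subr_le0// opprB.
  have : (s - s0) * (abs1 e + 1) < d.
    by rewrite -ltr_pdivlMr// ltrBlDl.
  apply: le_lt_trans; rewrite ler_wpM2l ?subr_ge0// lerDl//.
have s0p : 0 < s0.
  rewrite lt_neqAle s00 andbT; apply/eqP => s0E; apply: s0B.
  by rewrite -s0E /lam mul0r subr0; exact: (omA mu ommu).1.
have [F [FU s0F]] := ultraFilterLemma (at_left_proper_filter s0).
have FP : ProperFilter F by exact: ultra_proper.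
have Fs : \forall s \near F, 0 <= s < s0.
  apply: s0F; near=> s; apply/andP; split; last by near: s; exact: nbhs_left_lt.
  by apply: ltW; near: s; exact: nbhs_left_gt.
have Fid : s @[s --> F] --> s0.
  apply: (@cvg_trans _ (s0^'-)); last exact: cvg_within.
  by move=> V /s0F.
have Fabs : `|s - s0| @[s --> F] --> 0 by apply/norm_cvg0P/subr_cvg0.
have FB : \forall s \near F, resolvent_set B (lam s).
  by apply: filterS Fs => s /andP[]; exact: below.
have Fc : abs1 (lam s - lam s0) @[s --> F] --> 0.
  apply: (@cvg_trans _ ((fun s => `|s - s0| * abs1 e) @ F)).
    by apply: near_eq_cvg; apply: filterE => s; rewrite lamB abs1_real distrC.
  by rewrite -(mul0r (abs1 e)); exact: cvgMr_tmp.
have s0F' : fredholm (shift_op B (lam s0)).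
  by apply: aF; rewrite (lt_le_trans _ (lam_Re _ s00))//; lra.
have [x [v [b [Cx Fb b0 [vB vn0 Bv] bv]]]] := resolvent_blowup Ctotal FU FB Fc s0B s0F'.
clear s0B.
have tauB s : 0 <= s <= s0 -> resolvent_set B (mu - s)%:C%C.
  by move=> /andP[_ ss0]; apply: aB; lra.
have [d [M [d0 M0 dB]]] : exists (d M : R), [/\ 0 < d, 0 <= M &
    forall m, abs1 (m - (mu - s0)%:C%C) < d ->
    resolvent_set B m /\ forall z : XR, `|rres B m z| <= M * `|z|].
  by apply: resolvent_set_open; apply: tauB; rewrite s00 lexx.
have tau0 : (b s)^-1 *: rres B (mu - s)%:C%C (x, 0) @[s --> F] --> (0 : XR).
  apply/norm_cvg0P; apply: (@squeeze_cvgr _ _ _ _ (fun=> 0)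
    (fun s => (b s)^-1 * (M * `|((x, 0) : XR)|))).
  - have Fd : \forall s \near F, `|s - s0| < d.
      by have := @cvgr_lt _ _ _ _ _ _ Fabs _ d0; exact.
    apply: filterS2 Fd Fb => s sd [_ bs]; rewrite normr_ge0 normrZ.
    rewrite gtr0_norm ?invr_gt0//=.
    apply: ler_wpM2l; first by rewrite invr_ge0 ltW.
    apply: (dB _ _).2.
    have -> : (mu - s)%:C%C - (mu - s0)%:C%C = (s0 - s)%:C%C * 1 :> R[i].
      by rewrite !rmorphB/=; ring.
    by rewrite abs1_real /abs1/= normr0 normr1 addr0 mulr1 distrC.
  - exact: cvg_cst.
  - by rewrite -(mul0r (M * `|((x, 0) : XR)|)); exact: cvgMr_tmp.
(* Domination at s, divided by b s, in the limit. *)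
have Cv c : `|c| = 1 -> C (- (cmul c v).1).
  move=> c1.
  have cl : (b s)^-1 *: rres B (mu - s)%:C%C (x, 0) -
      cmul c ((b s)^-1 *: rres B (lam s) (x, 0)) @[s --> F] --> (0 - cmul c v : XR).
    apply: cvgB => //; apply: continuous_cvg => //.
    exact: (bounded_linear_continuous_at (cmul_linear c) (cmul_le c)).
  have cl1 : ((b s)^-1 *: rres B (mu - s)%:C%C (x, 0) -
      cmul c ((b s)^-1 *: rres B (lam s) (x, 0))).1 @[s --> F] --> (0 - cmul c v : XR).1.
    by apply: continuous_cvg => //; exact: cvg_fst.
  rewrite -[- _]sub0r; apply: (closed_cvg C (cone_closed hC) _ _ cl1).
  apply: filterS2 Fs Fb => s /andP[sge ss0] [_ bs].
  rewrite cmulZ -scalerBr; apply: (coneZ hC); first by rewrite invr_ge0 ltW.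
  apply: (resolvent_dominated hC) => //.
  - move=> t /andP[t0 ts]; apply: below => //; exact: le_lt_trans ss0.
  - move=> t /andP[t0 ts]; apply: tauB.
    by rewrite t0/= (le_trans ts)// ltW.
have v0 c : `|c| = 1 -> (cmul c v).1 = 0.
  move=> c1; have Cm := Cv c c1.
  have Cp : C (cmul c v).1.
    have := Cv (- c); rewrite normrN => /(_ c1).
    by rewrite /cmul scaleNr opprK.
  by have : (C `&` [set x | C (- x)]) (cmul c v).1 by []; rewrite (cone_pointed hC).
move/eqP: vn0; apply.
have v1 : v.1 = 0 by have := v0 1 (normr1 _); rewrite /cmul scale1r.
have v2 : v.2 = 0.
  have i1 : `|'i%C| = 1 :> R[i] by rewrite normc_def/= expr0n/= add0r expr1n sqrtr1.
  have := v0 _ i1; rewrite /cmul/= scale0r scale1r sub0r => /eqP.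
  by rewrite oppr_eq0 => /eqP.
by apply: injective_projections.
Unshelve. all: by end_near. Qed.

End SpectralBound.

Lemma ereal_lt0_real (R : realType) (x : \bar R) : (x < 0)%E ->
  exists2 a : R, a < 0 & (x <= a%:E)%E.
Proof.
case: x => [a||] //; first by rewrite lte_fin => a0; exists a.
by move=> _; exists (-1); rewrite ?ltrN10 ?leNye.
Qed.

Theorem corollary5p4 (R : realType) (X : completeNormedModType R)
    (C : set X) (A : linop X)
    (hC : ordered_banach C) (hCtotal : total_cone C)
    (hA : resolvent_positive C A)
    (hess : (essential_spectral_bound A < 0)%E) :
  [<-> (* (i) *)
       (spectral_bound A < 0)%E;
       (* (ii) *)
       resolvent_set (complexify A) 0 /\ positive_op C (resolvent A 0);
       (* (iii) *)
       forall x, dom A x -> cone_le C 0 (A x) -> cone_le C x 0;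
       (* (iv) *)
       forall x, dom A x -> x != 0 -> cone_le C 0 x -> ~ cone_le C 0 (A x)].
Proof.
have [a a0 ha] := ereal_lt0_real hess.
have fred l : a < complex.Re l -> fredholm (shift_op (complexify A) l).
  move=> al; apply: contrapT => nl.
  have : ((complex.Re l)%:E <= essential_spectral_bound A)%E.
    by apply: ereal_sup_ubound; exists l.
  by move=> /le_trans/(_ ha); rewrite lee_fin leNgt al.
tfae.
- move=> s0.
  have Bpos l : 0 <= complex.Re l -> resolvent_set (complexify A) l.
    move=> l0; apply: contrapT => nl.
    have : ((complex.Re l)%:E <= spectral_bound A)%E.
      by apply: ereal_sup_ubound; exists l.
    by move=> /le_lt_trans/(_ s0); rewrite lte_fin ltNge l0.
  split; first by apply: Bpos.
  by apply: (positive_resolvent hC hA) => s s0'; exact: Bpos.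
- move=> [zB Rpos] x xA; rewrite /cone_le subr0 sub0r => CAx.
  suff <- : resolvent A 0 (A x) = - x by exact: Rpos.
  have NxA : dom A (- x).
    by rewrite -scaleN1r; exact: subspaceZ (subspace_dom A) xA.
  have := @rresK _ _ (complexify A) 0 (- x, 0) zB (conj NxA (dom0 A)).
  rewrite /cmul scale0r sub0r => /(congr1 fst).
  have -> : - (complexify A ((- x, 0) : complexification X)) = (A x, 0) :> X * X.
    apply: injective_projections => /=.
      by rewrite -scaleN1r linopZ// scaleN1r opprK.
    by rewrite linop0 oppr0.
  by rewrite (@rres_real_part _ _ A 0).
- move=> iii x xA x0; rewrite {1}/cone_le subr0 => Cx CAx.
  have := iii x xA CAx; rewrite /cone_le sub0r => CNx.
  have : (C `&` [set x | C (- x)]) x by [].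
  by rewrite (cone_pointed hC); exact/eqP.
- move=> iv.
  (* A real spectral point t >= 0 would make the largest one an eigenvalue with
     an eigenvector in the cone. *)
  have real_res t : 0 <= t -> resolvent_set (complexify A) t%:C%C.
    move=> t0; apply: contrapT => tB; have [om omA] := hA.
    pose S := [set s | 0 <= s /\ ~ resolvent_set (complexify A) s%:C%C].
    have Ss : has_sup S.
      split; first by exists t.
      exists om => s [_ sB]; rewrite leNgt; apply/negP => /omA[sB' _].
      exact: sB sB'.
    pose s := sup S.
    have ts : t <= s by apply: (sup_upper_bound Ss); exact: conj t0 tB.
    clear tB.
    have above u : s < u -> resolvent_set (complexify A) u%:C%C.
      move=> su; apply: contrapT => uB.
      have : u <= s.
        apply: (sup_upper_bound Ss); split; last exact: uB.
        by rewrite (le_trans t0)// (le_trans ts)// ltW.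
      by rewrite leNgt su.
    have sB : ~ resolvent_set (complexify A) s%:C%C.
      move=> sB; have [d [M [d0 M0 dB]]] := resolvent_set_open sB.
      have [u [u0 uB] su] := sup_adherent d0 Ss.
      have us : u <= s by apply: (sup_upper_bound Ss); exact: conj u0 uB.
      move: uB; apply; apply: (dB _ _).1.
      rewrite -rmorphB /abs1/= normr0 addr0 ler0_norm ?subr_le0//.
      by rewrite opprB ltrBlDr -ltrBlDl.
    have [x [xA x0 Cx Ax]] := positive_eigenvector hC hCtotal hA above sB
      (fred s%:C%C (lt_le_trans a0 (le_trans t0 ts))).
    apply: (iv x xA x0); rewrite /cone_le subr0//.
    by rewrite Ax; apply: (coneZ hC) => //; exact: le_trans ts.
  have [d [M [d0 M0 dB]]] := resolvent_set_open (real_res 0 (lexx 0)).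
  (* By openness of the resolvent set there is room to the left of 0. *)
  pose a1 := Num.max a (- (d / 2)).
  have a10 : a1 < 0 by rewrite gt_max a0 oppr_lt0 divr_gt0.
  have a1B s : a1 <= s -> resolvent_set (complexify A) s%:C%C.
    rewrite ge_max => /andP[_ ds]; have [/real_res//|s0] := leP 0 s.
    apply: (dB _ _).1; rewrite subr0 /abs1/= normr0 addr0 ltr0_norm//.
    lra.
  have half := half_plane_resolvent hC hCtotal hA a1B.
  apply: (@le_lt_trans _ _ a1%:E); last by rewrite lte_fin.
  apply: ge_ereal_sup => _ [l lB <-]; rewrite lee_fin leNgt; apply/negP => al.
  apply: lB; apply: half => // l' al'; apply: fred.
  by rewrite (le_lt_trans _ al')// le_max lexx.
Qed.
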